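(* Let $f\colon X\to Y$ be a Reedy fibration between Segal spaces, and let $e\in X_{10}$ be an $f$-cocartesian edge. Then for all $n\ge2$ the map $$(\Delta^n\backslash X)^e\to(\Lambda^n_0\backslash X)^e\times_{(\Lambda^n_0\backslash Y)^{f(e)}}(\Delta^n\backslash Y)^{f(e)}$$ is a trivial (Kan) fibration.
   Context: A bisimplicial set is a functor $X\colon(\Delta^{op})^2\to\mathrm{Set}$, with sets $X_{mn}$. For simplicial sets $A,B$ put $(A\square B)_{mn}=A_m\times B_n$, and $(A\backslash X)_n=\mathrm{Hom}(A\square\Delta^n,X)$. A map $f\colon X\to Y$ is a Reedy fibration if for each monomorphism $u\colon A\to A'$ of simplicial sets the map $A'\backslash X\to A\backslash X\times_{A\backslash Y}A'\backslash Y$ is a Kan fibration. A Segal space is a Reedy fibrant bisimplicial set $X$ such that for all $n\ge2$ the map $\Delta^n\backslash X\to I_n\backslash X$ is a weak homotopy equivalence, where $I_n\subseteq\Delta^n$ is the spine (the union of the edges $\Delta^{\{i,i+1\}}$). For $A\subseteq\Delta^n$ a simplicial subset containing $\Delta^{\{0,1\}}$ and $e\in X_{10}$, put $(A\backslash X)^e=A\backslash X\times_{\Delta^{\{0,1\}}\backslash X}\{e\}$ (strict fiber product). For a Reedy fibration $f\colon X\to Y$ between Segal spaces, $e\in X_{10}$ is $f$-cocartesian if the square formed by $(\Delta^2\backslash X)^e\to(\Lambda^2_0\backslash X)^e$ (top), $(\Delta^2\backslash Y)^{f(e)}\to(\Lambda^2_0\backslash Y)^{f(e)}$ (bottom) and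 the vertical maps induced by $f$ is homotopy pullback (in the Kan model structure). *)

(* Defs.v *)
From HB Require Import structures.
From Stdlib Require Import Relation_Operators.
From mathcomp Require Import all_boot.
From mathcomp Require Import boolp.

Set Implicit Arguments.
Unset Strict Implicit.
Unset Printing Implicit Defensive.

Local Obligation Tactic := try (by []); intros; simpl.

(** * The simplex category

    [dhom m n] is the set of monotone maps [m] -> [n], where [n] = {0,...,n}
    is encoded as 'I_n.+1. *)

Record dhom (m n : nat) := DHom {
  dhom_fun :> {ffun 'I_m.+1 -> 'I_n.+1};
  _ : [forall i : 'I_m.+1, forall j : 'I_m.+1, (i <= j) ==> (dhom_fun i <= dhom_fun j)] }.

HB.instance Definition _ m n := [isSub for @dhom_fun m n].

Lemma dhom_homo m n (a : dhom m n) (i j : 'I_m.+1) : i <= j -> a i <= a j.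
Proof. by case: a => a /= /forallP/(_ i)/forallP/(_ j)/implyP; apply. Qed.

Lemma dhomP m n (a b : dhom m n) : (forall i, a i = b i) -> a = b.
Proof. by move=> h; apply: val_inj; apply/ffunP. Qed.

Lemma mkdhom_subproof m n (f : 'I_m.+1 -> 'I_n.+1) :
    (forall i j : 'I_m.+1, i <= j -> f i <= f j) ->
  [forall i : 'I_m.+1, forall j : 'I_m.+1, (i <= j) ==> (finfun f i <= finfun f j)].
Proof.
by move=> h; apply/forallP=> i; apply/forallP=> j; apply/implyP; rewrite !ffunE; apply: h.
Qed.

Definition mkdhom m n (f : 'I_m.+1 -> 'I_n.+1)
    (h : forall i j : 'I_m.+1, i <= j -> f i <= f j) : dhom m n :=
  DHom (mkdhom_subproof h).

Lemma mkdhomE m n f h i : @mkdhom m n f h i = f i.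
Proof. by rewrite /= ffunE. Qed.

Definition did n : dhom n n := @mkdhom n n id (fun i j h => h).

Definition dcomp l m n (b : dhom m n) (a : dhom l m) : dhom l n :=
  @mkdhom l n (fun i => b (a i)) (fun i j h => dhom_homo b (dhom_homo a h)).

Definition dconst m n (k : 'I_n.+1) : dhom m n :=
  @mkdhom m n (fun=> k) (fun _ _ _ => leqnn k).

Lemma dcompE l m n (b : dhom m n) (a : dhom l m) i : dcomp b a i = b (a i).
Proof. exact: mkdhomE. Qed.

Lemma dcompId m n (a : dhom m n) : dcomp a (did m) = a.
Proof. by apply: dhomP => i; rewrite dcompE mkdhomE. Qed.

Lemma dcompdI m n (a : dhom m n) : dcomp (did n) a = a.
Proof. by apply: dhomP => i; rewrite dcompE mkdhomE. Qed.

Lemma dcompA k l m n (c : dhom m n) (b : dhom l m) (a : dhom k l) :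
  dcomp c (dcomp b a) = dcomp (dcomp c b) a.
Proof. by apply: dhomP => i; rewrite !dcompE. Qed.

Lemma dcomp_const l m n (k : 'I_n.+1) (a : dhom l m) :
  dcomp (dconst m k) a = dconst l k.
Proof. by apply: dhomP => i; rewrite dcompE !mkdhomE. Qed.

Lemma edge01_subproof n (i j : 'I_2) : i <= j ->
  (inord (minn i n) : 'I_n.+1) <= (inord (minn j n) : 'I_n.+1).
Proof. by move=> h; rewrite !inordK ?ltnS ?geq_minr// leq_min geq_minr geq_min h. Qed.

(** The inclusion [1] -> [n], 0 |-> 0, 1 |-> 1, when n >= 1
    (and the constant map when n = 0). *)
Definition edge01 n : dhom 1 n :=
  @mkdhom 1 n (fun i => inord (minn i n)) (@edge01_subproof n).

(** * Simplicial sets *)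

Record sSet := SSet {
  sobj :> nat -> Type;
  sact : forall m n, dhom m n -> sobj n -> sobj m;
  sact_id : forall n (x : sobj n), sact (did n) x = x;
  sact_comp : forall l m n (b : dhom m n) (a : dhom l m) (x : sobj n),
    sact (dcomp b a) x = sact a (sact b x) }.

Arguments sact {_ m n} _ _.

Record smap (A B : sSet) := SMap {
  smap_fun :> forall n, A n -> B n;
  smap_nat : forall m n (a : dhom m n) (x : A n),
    smap_fun (sact a x) = sact a (smap_fun x) }.

Arguments smap_fun {A B} _ n _.

Lemma smapP (A B : sSet) (f g : smap A B) :
  (forall n (x : A n), f n x = g n x) -> f = g.
Proof.
case: f g => [f hf] [g hg] /= h.
have e : f = g by apply: functional_extensionality_dep => n; apply: funext => x.
by subst g; congr SMap; apply: Prop_irrelevance.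
Qed.

Program Definition sidm (A : sSet) : smap A A := @SMap A A (fun n x => x) _.

Program Definition scomp (A B C : sSet) (g : smap B C) (f : smap A B) : smap A C :=
  @SMap A C (fun n x => g n (f n x)) _.
Next Obligation. by rewrite !smap_nat. Qed.

Definition smono (A B : sSet) (u : smap A B) : Prop :=
  forall (C : sSet) (g h : smap C A), scomp u g = scomp u h -> g = h.

Program Definition simplex (n : nat) : sSet :=
  @SSet (fun m => dhom m n) (fun l m a x => dcomp x a) _ _.
Next Obligation. exact: dcompId. Qed.
Next Obligation. exact: dcompA. Qed.

Program Definition yoneda (A : sSet) n (x : A n) : smap (simplex n) A :=
  @SMap (simplex n) A (fun m a => sact a x) _.
Next Obligation. exact: sact_comp. Qed.

Program Definition spt : sSet := @SSet (fun=> unit) (fun _ _ _ x => x) _ _.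

Program Definition to_pt (A : sSet) : smap A spt := @SMap A spt (fun _ _ => tt) _.

(** The map from the point to A picking out a vertex. *)
Program Definition pt_incl (A : sSet) (x : A 0) : smap spt A :=
  @SMap spt A (fun m _ => sact (dconst m ord0) x) _.
Next Obligation. by rewrite -sact_comp dcomp_const. Qed.

Program Definition sprod (A B : sSet) : sSet :=
  @SSet (fun n => (A n * B n)%type) (fun m n a x => (sact a x.1, sact a x.2)) _ _.
Next Obligation. by case: x => x y; rewrite /= !sact_id. Qed.
Next Obligation. by rewrite !sact_comp. Qed.

(** ** Subcomplexes *)

Record subcpx (A : sSet) := SubCpx {
  scmem : forall n, A n -> Prop;
  sc_act : forall m n (a : dhom m n) (x : A n), scmem x -> scmem (sact a x) }.

Arguments scmem {A} _ {n}.

Program Definition sc_sset (A : sSet) (S : subcpx A) : sSet :=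
  @SSet (fun n => {x : A n | scmem S x})
        (fun m n a x => exist _ (sact a (proj1_sig x)) (sc_act a (proj2_sig x))) _ _.
Next Obligation. by case: x => x h; apply: eq_exist; apply: sact_id. Qed.
Next Obligation. by apply: eq_exist; apply: sact_comp. Qed.

Program Definition sc_incl (A : sSet) (S : subcpx A) : smap (sc_sset S) A :=
  @SMap (sc_sset S) A (fun n x => proj1_sig x) _.

(** The face of the n-simplex spanned by the set of vertices S. *)
Program Definition face n (S : {set 'I_n.+1}) : subcpx (simplex n) :=
  @SubCpx (simplex n) (fun m (a : dhom m n) => forall i, a i \in S) _.
Next Obligation. by move=> i; rewrite dcompE. Qed.

Lemma sc_bigcup_subproof (A : sSet) (I : Type) (P : I -> Prop) (F : I -> subcpx A)
    m n (a : dhom m n) (x : A n) :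
  (exists2 i, P i & scmem (F i) x) -> exists2 i, P i & scmem (F i) (sact a x).
Proof. by move=> [i Pi xi]; exists i => //; apply: sc_act. Qed.

Definition sc_bigcup (A : sSet) (I : Type) (P : I -> Prop)
    (F : I -> subcpx A) : subcpx A :=
  SubCpx (@sc_bigcup_subproof A I P F).

Definition horn n (k : 'I_n.+1) : subcpx (simplex n) :=
  sc_bigcup (fun i : 'I_n.+1 => i != k) (fun i => face [set~ i]).

Definition spine n : subcpx (simplex n) :=
  sc_bigcup (fun i : 'I_n.+1 => i < n)
            (fun i => face [set j : 'I_n.+1 | i <= j <= i.+1]).

(** ** Fiber products *)

Program Definition spull (A B C : sSet) (f : smap A C) (g : smap B C) : sSet :=
  @SSet (fun n => {p : A n * B n | f n p.1 = g n p.2})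
        (fun m n a p => exist _ (sact a (proj1_sig p).1, sact a (proj1_sig p).2) _) _ _.
Next Obligation. by rewrite !smap_nat (proj2_sig p). Qed.
Next Obligation. by case: x => [[x y] h]; apply: eq_exist; rewrite /= !sact_id. Qed.
Next Obligation. by apply: eq_exist; rewrite /= !sact_comp. Qed.

Program Definition spull_pair (Z A B C : sSet) (f : smap A C) (g : smap B C)
    (h : smap Z A) (k : smap Z B) (H : scomp f h = scomp g k) : smap Z (spull f g) :=
  @SMap Z (spull f g) (fun n z => exist _ (h n z, k n z) _) _.
Next Obligation. exact: (congr1 (fun F : smap Z C => F n z) H). Qed.
Next Obligation. by apply: eq_exist; rewrite /= !smap_nat. Qed.

Program Definition spull_fst (A B C : sSet) (f : smap A C) (g : smap B C) :
    smap (spull f g) A := @SMap (spull f g) A (fun n p => (proj1_sig p).1) _.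

Program Definition spull_snd (A B C : sSet) (f : smap A C) (g : smap B C) :
    smap (spull f g) B := @SMap (spull f g) B (fun n p => (proj1_sig p).2) _.

Lemma spull_sq (A B C : sSet) (f : smap A C) (g : smap B C) :
  scomp f (spull_fst f g) = scomp g (spull_snd f g).
Proof. by apply: smapP => n [p hp]. Qed.

(** * The Kan model structure *)

Definition has_rlp (A B E D : sSet) (i : smap A B) (p : smap E D) : Prop :=
  forall (a : smap A E) (b : smap B D), scomp p a = scomp b i ->
  exists2 l : smap B E, scomp l i = a & scomp p l = b.

Definition kan_fibration (E D : sSet) (p : smap E D) : Prop :=
  forall n (k : 'I_n.+1), 0 < n -> has_rlp (sc_incl (horn k)) p.

Definition kan_complex (K : sSet) : Prop := kan_fibration (to_pt K).

Definition elem_homotopic (A K : sSet) (g h : smap A K) : Prop :=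
  exists2 H : smap (sprod A (simplex 1)) K,
    forall n (x : A n), H n (x, dconst n ord0) = g n x
  & forall n (x : A n), H n (x, dconst n ord_max) = h n x.

Definition homotopic (A K : sSet) : smap A K -> smap A K -> Prop :=
  clos_refl_sym_trans (smap A K) (@elem_homotopic A K).

(** u : A -> B is a weak homotopy equivalence when, for every Kan complex K,
    precomposition with u is a bijection [B, K] -> [A, K] on homotopy classes,
    i.e. pi_0(K^B) -> pi_0(K^A) is bijective. *)
Definition weak_equivalence (A B : sSet) (u : smap A B) : Prop :=
  forall K : sSet, kan_complex K ->
    (forall g h : smap B K, homotopic (scomp g u) (scomp h u) -> homotopic g h) /\
    (forall g : smap A K, exists h : smap B K, homotopic (scomp h u) g).

Definition trivial_fibration (E D : sSet) (p : smap E D) : Prop :=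
  kan_fibration p /\ weak_equivalence p.

Lemma hpull_subproof (A B C D U : sSet) (top : smap A B) (left : smap A C)
    (right : smap B D) (bot : smap C D) (i : smap B U) (r : smap U D) :
    scomp right top = scomp bot left -> scomp r i = right ->
  scomp r (scomp i top) = scomp bot left.
Proof. by move=> <- <-; apply: smapP. Qed.

(** The commutative square
<<
      A --top--> B
      |          |
    left       right
      v          v
      C --bot--> D
>>
    is homotopy pullback when, for any factorization of [right] as a weak
    equivalence i : B -> U followed by a Kan fibration r : U -> D, the induced
    map A -> U x_D C is a weak equivalence.  Replacing only one leg by a
    fibration is enough because the Kan model structure is right proper. *)
Definition homotopy_pullback (A B C D : sSet) (top : smap A B) (left : smap A C)
    (right : smap B D) (bot : smap C D)
    (sq : scomp right top = scomp bot left) : Prop :=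
  forall (U : sSet) (i : smap B U) (r : smap U D) (fac : scomp r i = right),
    weak_equivalence i -> kan_fibration r ->
    weak_equivalence (spull_pair (hpull_subproof sq fac)).

(** * Bisimplicial sets *)

Record bsSet := BSSet {
  bobj :> nat -> nat -> Type;
  bact : forall m m' n n', dhom m m' -> dhom n n' -> bobj m' n' -> bobj m n;
  bact_id : forall m n (x : bobj m n), bact (did m) (did n) x = x;
  bact_comp : forall m m' m'' n n' n'' (b : dhom m' m'') (a : dhom m m')
      (d : dhom n' n'') (c : dhom n n') (x : bobj m'' n''),
    bact (dcomp b a) (dcomp d c) x = bact a c (bact b d x) }.

Arguments bact {_ m m' n n'} _ _ _.

Record bmap (X Y : bsSet) := BMap {
  bmap_fun :> forall m n, X m n -> Y m n;
  bmap_nat : forall m m' n n' (a : dhom m m') (b : dhom n n') (x : X m' n'),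
    bmap_fun (bact a b x) = bact a b (bmap_fun x) }.

Arguments bmap_fun {X Y} _ m n _.

Lemma bmapP (X Y : bsSet) (f g : bmap X Y) :
  (forall m n (x : X m n), f m n x = g m n x) -> f = g.
Proof.
case: f g => [f hf] [g hg] /= h.
have e : f = g.
  apply: functional_extensionality_dep => m.
  by apply: functional_extensionality_dep => n; apply: funext => x.
by subst g; congr BMap; apply: Prop_irrelevance.
Qed.

Program Definition bcomp (X Y Z : bsSet) (g : bmap Y Z) (f : bmap X Y) : bmap X Z :=
  @BMap X Z (fun m n x => g m n (f m n x)) _.
Next Obligation. by rewrite !bmap_nat. Qed.

Program Definition bpt : bsSet := @BSSet (fun _ _ => unit) (fun _ _ _ _ _ _ x => x) _ _.

Program Definition to_bpt (X : bsSet) : bmap X bpt := @BMap X bpt (fun _ _ _ => tt) _.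

Program Definition box (A B : sSet) : bsSet :=
  @BSSet (fun m n => (A m * B n)%type)
         (fun m m' n n' a b x => (sact a x.1, sact b x.2)) _ _.
Next Obligation. by case: x => x y; rewrite /= !sact_id. Qed.
Next Obligation. by rewrite !sact_comp. Qed.

Program Definition box_map (A A' B B' : sSet) (u : smap A A') (v : smap B B') :
    bmap (box A B) (box A' B') :=
  @BMap (box A B) (box A' B') (fun m n x => (u m x.1, v n x.2)) _.
Next Obligation. by rewrite !smap_nat. Qed.

Program Definition simplex_map m n (a : dhom m n) : smap (simplex m) (simplex n) :=
  @SMap (simplex m) (simplex n) (fun l b => dcomp a b) _.
Next Obligation. exact: dcompA. Qed.

(** [bslash A X] is A\X. *)
Program Definition bslash (A : sSet) (X : bsSet) : sSet :=
  @SSet (fun n => bmap (box A (simplex n)) X)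
        (fun m n a phi => bcomp phi (box_map (sidm A) (simplex_map a))) _ _.
Next Obligation.
by apply: bmapP => p q [y c] /=; rewrite dcompdI.
Qed.
Next Obligation.
by apply: bmapP => p q [y c] /=; rewrite dcompA.
Qed.

Program Definition bslash_res (A A' : sSet) (u : smap A A') (X : bsSet) :
    smap (bslash A' X) (bslash A X) :=
  @SMap (bslash A' X) (bslash A X)
    (fun n phi => bcomp phi (box_map u (sidm (simplex n)))) _.
Next Obligation. by apply: bmapP. Qed.

Program Definition bslash_push (A : sSet) (X Y : bsSet) (f : bmap X Y) :
    smap (bslash A X) (bslash A Y) :=
  @SMap (bslash A X) (bslash A Y) (fun n phi => bcomp f phi) _.
Next Obligation. by apply: bmapP. Qed.

Lemma bslash_sq (A A' : sSet) (u : smap A A') (X Y : bsSet) (f : bmap X Y) :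
  scomp (bslash_push A f) (bslash_res u X) = scomp (bslash_res u Y) (bslash_push A' f).
Proof. by apply: smapP => n phi; apply: bmapP. Qed.

(** A'\X -> A\X x_{A\Y} A'\Y *)
Definition bslash_gap (A A' : sSet) (u : smap A A') (X Y : bsSet) (f : bmap X Y) :
    smap (bslash A' X) (spull (bslash_push A f) (bslash_res u Y)) :=
  spull_pair (bslash_sq u f).

Definition reedy_fibration (X Y : bsSet) (f : bmap X Y) : Prop :=
  forall (A A' : sSet) (u : smap A A'), smono u -> kan_fibration (bslash_gap u f).

Definition reedy_fibrant (X : bsSet) : Prop := reedy_fibration (to_bpt X).

Definition segal_space (X : bsSet) : Prop :=
  reedy_fibrant X /\
  forall n, 2 <= n -> weak_equivalence (bslash_res (sc_incl (spine n)) X).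

(** The vertex of (simplex 1)\X corresponding to e in X_{10} under the
    Yoneda isomorphism Hom(simplex 1 [] simplex 0, X) = X_{10}. *)
Program Definition edge_vertex (X : bsSet) (e : X 1 0) : bslash (simplex 1) X 0 :=
  @BMap (box (simplex 1) (simplex 0)) X (fun m n x => bact x.1 x.2 e) _.
Next Obligation. by rewrite bact_comp. Qed.

(** (A\X)^e, for a simplicial set A with a distinguished edge a in A_1: the
    strict fiber over e of restriction along a : simplex 1 -> A.  For A a
    subcomplex of the n-simplex, n >= 1, a is the edge 0 -> 1, which identifies
    simplex 1 with the face on the vertices 0 and 1. *)
Definition bfib (A : sSet) (a : A 1) (X : bsSet) (e : X 1 0) : sSet :=
  spull (bslash_res (yoneda a) X) (pt_incl (edge_vertex e)).

Lemma bfib_res_subproof (A A' : sSet) (u : smap A A') (a : A 1) (X : bsSet) (e : X 1 0) :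
  scomp (bslash_res (yoneda a) X)
    (scomp (bslash_res u X)
      (spull_fst (bslash_res (yoneda (u 1 a)) X) (pt_incl (edge_vertex e)))) =
  scomp (pt_incl (edge_vertex e))
    (spull_snd (bslash_res (yoneda (u 1 a)) X) (pt_incl (edge_vertex e))).
Proof.
rewrite -spull_sq; apply: smapP => n p; apply: bmapP => k l [x b] /=.
by rewrite smap_nat.
Qed.

Definition bfib_res (A A' : sSet) (u : smap A A') (a : A 1) (X : bsSet) (e : X 1 0) :
    smap (bfib (u 1 a) e) (bfib a e) :=
  spull_pair (bfib_res_subproof u a e).

Lemma bfib_push_subproof (A : sSet) (a : A 1) (X Y : bsSet) (f : bmap X Y) (e : X 1 0) :
  scomp (bslash_res (yoneda a) Y)
    (scomp (bslash_push A f)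
      (spull_fst (bslash_res (yoneda a) X) (pt_incl (edge_vertex e)))) =
  scomp (pt_incl (edge_vertex (f 1 0 e)))
    (spull_snd (bslash_res (yoneda a) X) (pt_incl (edge_vertex e))).
Proof.
apply: smapP => n [[phi t] h]; apply: bmapP => k l x.
have /= -> := congr1 (fun F : bmap _ X => f k l (F k l x)) h.
by rewrite bmap_nat.
Qed.

Definition bfib_push (A : sSet) (a : A 1) (X Y : bsSet) (f : bmap X Y) (e : X 1 0) :
    smap (bfib a e) (bfib a (f 1 0 e)) :=
  spull_pair (bfib_push_subproof a f e).

Lemma bfib_sq (A A' : sSet) (u : smap A A') (a : A 1) (X Y : bsSet) (f : bmap X Y)
    (e : X 1 0) :
  scomp (bfib_push a f e) (bfib_res u a e) =
  scomp (bfib_res u a (f 1 0 e)) (bfib_push (u 1 a) f e).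
Proof. by apply: smapP => n p; apply: eq_exist; congr pair; apply: bmapP. Qed.

(** (A'\X)^e -> (A\X)^e x_{(A\Y)^f(e)} (A'\Y)^f(e) *)
Definition bfib_gap (A A' : sSet) (u : smap A A') (a : A 1) (X Y : bsSet)
    (f : bmap X Y) (e : X 1 0) :
    smap (bfib (u 1 a) e) (spull (bfib_push a f e) (bfib_res u a (f 1 0 e))) :=
  spull_pair (bfib_sq u a f e).

Lemma horn0_edge01 n : 2 <= n -> scmem (horn (ord0 : 'I_n.+1)) (edge01 n).
Proof.
move=> n2; exists ord_max; first by rewrite -val_eqE /= -lt0n ltnW.
move=> i; rewrite !inE -val_eqE mkdhomE /= inordK ?ltnS ?geq_minr//.
by rewrite neq_ltn gtn_min (leq_ltn_trans _ n2) // -ltnS ltn_ord.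
Qed.

(** The edge 0 -> 1 of the horn; [sc_incl] sends it to [edge01 n] by
    conversion. *)
Definition horn_edge n (n2 : 2 <= n) : sc_sset (horn (ord0 : 'I_n.+1)) 1 :=
  exist _ (edge01 n) (horn0_edge01 n2).

Definition horn0_incl n : smap (sc_sset (horn (ord0 : 'I_n.+1))) (simplex n) :=
  sc_incl (horn ord0).

Definition cocartesian (X Y : bsSet) (f : bmap X Y) (e : X 1 0) : Prop :=
  homotopy_pullback (bfib_sq (horn0_incl 2) (horn_edge (leqnn 2)) f e).

(* Main.v *)
Require Import Defs.
From Stdlib Require Import Relation_Operators.
From mathcomp Require Import all_boot zify.
From mathcomp Require Import boolp.
From mathcomp Require classical_sets.

(** Call an inclusion K -> L of subcomplexes of the N-simplex good when its gap
    map over [e] has the right lifting property against boundary inclusions.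
    Between Kan complexes a Kan fibration has this property exactly when it is
    a weak equivalence; so if K -> L and K -> M are good, then L -> M is good.
    Good inclusions are also stable under composition (if 01 lies in K) and
    under attaching faces.  Spine inclusions are good by
    the Segal condition, hence so is the union of the faces spanned by the
    vertices <= x and >= x.  The cocartesian edge provides the horn of the
    triangle 01x.  With x the least vertex in V, where V consists of vertices
    > 1, and faces denoted by their vertices, this gives

      01 u 0x u V  ->  01x u V  ->  01V    and    01 u 0x u V  ->  01 u 0V,

    so that 01 u 0V -> 01V is good by cancellation.  Adding the faces
    opposite to the vertices of V one at a time turns 01 u 0V into the horn;
    each is attached along a complex of the same kind in lower dimension.

    The comparison of weak equivalences with lifting properties is Dold's
    argument, which only needs lifts of Kan fibrations against
    A x 0 u S x I -> A x I. *)

Set Implicit Arguments.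
Unset Strict Implicit.
Unset Printing Implicit Defensive.

Local Obligation Tactic := try (by []); intros; simpl.

(** * Extensionality, maps into subcomplexes, and unique choice *)

Lemma subcpxP (A : sSet) (S T : subcpx A) :
  (forall n (x : A n), scmem S x <-> scmem T x) -> S = T.
Proof.
case: S T => [S hS] [T hT] /= h.
have e : S = T.
  apply: functional_extensionality_dep => n; apply: funext => x.
  by apply: propext; apply: h.
by subst T; congr SubCpx; apply: Prop_irrelevance.
Qed.

Lemma smap_eqP (A B : sSet) (f g : smap A B) : f = g -> forall n x, f n x = g n x.
Proof. by move=> ->. Qed.

Program Definition sc_preim (C Z : sSet) (phi : smap C Z) (T : subcpx Z) : subcpx C :=
  @SubCpx C (fun n c => scmem T (phi n c)) _.
Next Obligation. by rewrite smap_nat; apply: sc_act. Qed.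

Program Definition sc_lift (C A : sSet) (S : subcpx A) (g : smap C A)
    (h : forall n c, scmem S (g n c)) : smap C (sc_sset S) :=
  @SMap C (sc_sset S) (fun n c => exist _ (g n c) (h n c)) _.
Next Obligation. by apply: eq_exist; apply: smap_nat. Qed.

(** Pointwise choices are natural because both sides of the naturality equation satisfy [R] at the
    same simplex, where [R] is functional. This turns graphs back into simplicial maps. *)
Lemma smap_unique_choice (A B : sSet) (R : forall n, A n -> B n -> Prop) :
    (forall n x, exists y, R n x y) ->
    (forall n x y y', R n x y -> R n x y' -> y = y') ->
    (forall m n (a : dhom m n) x y, R n x y -> R m (sact a x) (sact a y)) ->
  exists f : smap A B, forall n x, R n x (f n x).
Proof.
move=> tot fn nat.
pose F n x := proj1_sig (cid (tot n x)).
have FR n x : R n x (F n x) by apply: (proj2_sig (cid (tot n x))).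
have FN m n (a : dhom m n) x : F m (sact a x) = sact a (F n x).
  by apply: (fn m (sact a x)) => //; apply: nat.
by exists (SMap FN).
Qed.

(** * Lifting against subcomplexes

    A partial lift of [b : Z -> D] through [p : E -> D] is represented by its
    graph, a subcomplex of [Z x E]. *)

Definition graph_at (Z E : sSet) (G : subcpx (sprod Z E)) n (z : Z n) (y : E n) : Prop :=
  @scmem _ G n (z, y).

Program Definition gdom (Z E : sSet) (G : subcpx (sprod Z E)) : subcpx Z :=
  @SubCpx Z (fun n z => exists y, graph_at G z y) _.
Next Obligation.
by case: H => y Gy; exists (sact a y); apply: (@sc_act _ G _ _ a (x, y)).
Qed.

Lemma graph_at_act (Z E : sSet) (G : subcpx (sprod Z E)) m n (a : dhom m n) (z : Z n) (y : E n) :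
  graph_at G z y -> graph_at G (sact a z) (sact a y).
Proof. exact: (@sc_act _ G _ _ a (z, y)). Qed.

Section PartialLifts.
Variables (E D : sSet) (p : smap E D).

Definition partial_lift (Z : sSet) (b : smap Z D) (G : subcpx (sprod Z E)) : Prop :=
  (forall n (z : Z n) (y y' : E n), graph_at G z y -> graph_at G z y' -> y = y') /\
  (forall n (z : Z n) (y : E n), graph_at G z y -> p n y = b n z).

(** Together with [extend_rlp] this restates the lifting property for graphs. Partial lifts with
    varying domains then all live in one product, where they can be compared and united. *)
Lemma rlp_extend (Z : sSet) (S : subcpx Z) : has_rlp (sc_incl S) p ->
  forall (b : smap Z D) G, partial_lift b G -> gdom G = S ->
  exists2 l : smap Z E, scomp p l = b & forall n z y, graph_at G z y -> l n z = y.
Proof.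
move=> rlp b G [Gfun Gb] domG.
have [a aG] : exists a : smap (sc_sset S) E,
    forall n x, graph_at G (proj1_sig x) (a n x).
  apply: (@smap_unique_choice (sc_sset S) E (fun n x y => graph_at G (proj1_sig x) y)).
  - by move=> n [x /=]; rewrite -domG.
  - by move=> n x y y'; apply: Gfun.
  - by move=> m n c x y; apply: graph_at_act.
have [|l la lb] := rlp a b.
  by apply: smapP => n x /=; rewrite (Gb _ _ _ (aG n x)).
exists l => // n z y Gzy.
have Sz : scmem S z by rewrite -domG; exists y.
have /= := smap_eqP la (exist _ z Sz) => ->.
by apply: Gfun (aG n (exist _ z Sz)) Gzy.
Qed.

Lemma extend_rlp (Z : sSet) (S : subcpx Z) :
  (forall (b : smap Z D) G, partial_lift b G -> gdom G = S ->
    exists2 l : smap Z E, scomp p l = b & forall n z y, graph_at G z y -> l n z = y) ->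
  has_rlp (sc_incl S) p.
Proof.
move=> ext a b ab.
pose G0 n (zy : sprod Z E n) := exists h : scmem S zy.1, zy.2 = a n (exist _ zy.1 h).
have G0P m n (c : dhom m n) (x : sprod Z E n) : G0 n x -> G0 m (sact c x).
  case: x => z y [/= h ->]; exists (sc_act c h) => /=.
  by rewrite -smap_nat; congr (a m _); apply: eq_exist.
pose G := SubCpx G0P.
have [||l lb lG] := ext b G.
- split=> n z y.
    by move=> y' [/= h ->] [/= h' ->]; congr (a n _); apply: eq_exist.
  by case=> [/= h ->]; apply: (smap_eqP ab (exist _ z h)).
- apply: subcpxP => n z; split; first by case=> y [].
  by move=> h; exists (a n (exist _ z h)), h.
exists l => //; apply: smapP => n [z h] /=.
by apply: lG; exists h.
Qed.

Lemma partial_lift_total (Z : sSet) (b : smap Z D) (G : subcpx (sprod Z E)) :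
    partial_lift b G -> (forall n (z : Z n), scmem (gdom G) z) ->
  exists2 l : smap Z E, scomp p l = b & forall n z y, graph_at G z y -> l n z = y.
Proof.
move=> [Gfun Gb] tot.
have [l lG] := smap_unique_choice tot Gfun (fun m n c x y => @graph_at_act _ _ G m n c x y).
exists l; first by apply: smapP => n x; apply: Gb.
by move=> n z y; apply: Gfun.
Qed.

(* Attaching [C] along [phi], where [phi] is injective outside the preimage of
   the domain: the union is a pushout. *)
Lemma partial_lift_glue (Z C : sSet) (b : smap Z D) (G : subcpx (sprod Z E))
    (phi : smap C Z) :
    partial_lift b G ->
    (forall n (c c' : C n), phi n c = phi n c' -> ~ scmem (gdom G) (phi n c) -> c = c') ->
    has_rlp (sc_incl (sc_preim phi (gdom G))) p ->
  exists G' : subcpx (sprod Z E), [/\ partial_lift b G',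
    forall n (z : Z n) (y : E n), graph_at G z y -> graph_at G' z y &
    forall n (z : Z n), scmem (gdom G') z <-> scmem (gdom G) z \/ exists c, phi n c = z].
Proof.
move=> Gp inj rlp; have [Gfun Gb] := Gp.
pose H0 n (cy : sprod C E n) := graph_at G (phi n cy.1) cy.2.
have H0P m n (c : dhom m n) (x : sprod C E n) : H0 n x -> H0 m (sact c x).
  by case: x => z y /=; rewrite /H0 /= smap_nat => /graph_at_act; apply.
have [||l lb lH] := rlp_extend rlp (b := scomp b phi) (G := SubCpx H0P).
- by split=> n z y; [move=> y'; apply: Gfun | apply: Gb].
- by apply: subcpxP.
pose G1 n (zy : sprod Z E n) := graph_at G zy.1 zy.2 \/
  exists2 c, phi n c = zy.1 & l n c = zy.2.
have G1P m n (c : dhom m n) (x : sprod Z E n) : G1 n x -> G1 m (sact c x).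
  case: x => z y /= [/graph_at_act h|[d /= <- <-]]; first by left; apply: h.
  by right; exists (sact c d); rewrite /= smap_nat.
exists (SubCpx G1P); split.
- split=> n z y.
  + have aux c w w' : phi n c = z -> graph_at G z w -> l n c = w' -> w = w'.
      by move=> ez Gw <-; symmetry; apply: lH; rewrite /graph_at/= /H0 /= ez.
    move=> y' [/= Gy|[c /= cz cy]] [/= Gy'|[c' /= cz' cy']].
    * exact: Gfun Gy Gy'.
    * exact: aux cz' Gy cy'.
    * by symmetry; apply: aux cz Gy' cy.
    (* Two values both coming from [C]: outside the old domain [phi] is injective, so [c = c'];
       inside it both values equal the old one. *)
    * have [h|h] := pselect (scmem (gdom G) z); last first.
        by rewrite -cy -cy'; congr (l n _); apply: inj; rewrite ?cz ?cz'.
      case: h => w Gw; transitivity w; first by symmetry; apply: aux cz Gw cy.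
      exact: aux cz' Gw cy'.
  + case=> [/= /Gb//|[c /= <- <-]]; exact: (smap_eqP lb).
- by move=> n z y; left.
- move=> n z; split.
    by case=> y [/= Gy|[c /= cz _]]; [left; exists y|right; exists c].
  by case=> [[y Gy]|[c cz]]; [exists y; left|exists (l n c); right; exists c].
Qed.

(** A maximal partial lift among those satisfying the invariant [Q] and extending [G0] is total,
    since otherwise the last hypothesis would enlarge it. *)
Lemma partial_lift_zorn (Z : sSet) (b : smap Z D) (G0 : subcpx (sprod Z E))
    (Q : subcpx (sprod Z E) -> Prop) :
    partial_lift b G0 -> Q G0 ->
    (forall (I : Type) (F : I -> subcpx (sprod Z E)) (P : I -> Prop),
       (forall i, P i -> Q (F i)) -> Q (sc_bigcup P F)) ->
    (forall G, partial_lift b G -> Q G ->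
       (forall n z (y : E n), graph_at G0 z y -> graph_at G z y) ->
       (exists n (z : Z n), ~ scmem (gdom G) z) ->
     exists G', [/\ partial_lift b G', Q G',
       forall n z (y : E n), graph_at G z y -> graph_at G' z y &
       exists n (z : Z n), scmem (gdom G') z /\ ~ scmem (gdom G) z]) ->
  exists2 l : smap Z E, scomp p l = b & forall n z y, graph_at G0 z y -> l n z = y.
Proof.
move=> G0p G0Q chain step.
pose good G := [/\ partial_lift b G, Q G &
  forall n z (y : E n), graph_at G0 z y -> graph_at G z y].
pose R (s t : {G | good G}) := forall n z (y : E n),
  graph_at (proj1_sig s) z y -> graph_at (proj1_sig t) z y.
have good0 : good G0 by split.
have [||||[G Gg] Gmax] := @classical_sets.Zorn _ (fun s t => `[< R s t >]).
- by move=> s; apply/asboolP => n z y.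
- by move=> r s t /asboolP rs /asboolP st; apply/asboolP => n z y h; apply: st; apply: rs.
- move=> [s hs] [t ht] /asboolP st /asboolP ts; apply: eq_exist; apply: subcpxP => n [z y].
  by split; [apply: st|apply: ts].
- move=> A Atot.
  (* Adjoining [G0] makes the union an upper bound that extends [G0] even when the chain [A] is
     empty. *)
  pose P (s : {G | good G}) := A s \/ s = exist _ G0 good0.
  pose U := sc_bigcup P (fun s => proj1_sig s).
  have Ug : good U.
    split.
    + split=> n z y.
        move=> y' [s Ps sy] [t Pt ty].
        have sub0 r : P r -> forall n z (y : E n), graph_at G0 z y -> graph_at (proj1_sig r) z y.
          move=> _ k w v Gv; case: (proj2_sig r) => _ _; exact.
        have [st|ts] : R s t \/ R t s.
          case: (Ps) => [As|->]; last by left=> k w v; exact (sub0 t Pt k w v).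
          case: Pt => [At|->]; last by right=> k w v; exact (sub0 s Ps k w v).
          by case: (Atot s t As At) => /asboolP h; [left|right].
        - by case: (proj2_sig t) => -[fn _] _ _; apply: (fn n z) => //; apply: st.
        - by case: (proj2_sig s) => -[fn _] _ _; apply: (fn n z) => //; apply: ts.
      by case=> -[s [[_ sb] sQ sub]] _ /=; apply: sb.
    + by apply: chain => -[s [sp sQ sub]].
    + by move=> n z y h; exists (exist _ G0 good0) => //; right.
  exists (exist _ U Ug) => s As; apply/asboolP => n z y sy.
  by exists s => //; left.
have [Gp GQ G0G] := Gg.
have [tot|ntot] := pselect (forall n (z : Z n), scmem (gdom G) z).
  have [l lb lG] := partial_lift_total Gp tot.
  by exists l => // n z y /G0G; apply: lG.
case: (step G) => //.
  apply: contrapT => h; apply: ntot => n z; apply: contrapT => hz.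
  by apply: h; exists n, z.
move=> G' [G'p G'Q GG' [n [z [[y zG'] zG]]]].
have G'g : good G' by split => // k w v /G0G; apply: GG'.
have := Gmax (exist _ G' G'g) (introT (asboolP _) GG') => -[e].
by case: zG; exists y; rewrite -e.
Qed.

End PartialLifts.

(** * Boundaries and cells *)

Definition bdry n : subcpx (simplex n) :=
  sc_bigcup (fun _ : 'I_n.+1 => True) (fun i => face [set~ i]).

Lemma bdryP n m (a : dhom m n) :
  scmem (bdry n) (a : simplex n m) <-> exists i, forall t, a t != i.
Proof.
split=> [[i _ h]|[i h]]; exists i => // t; first by have := h t; rewrite !inE.
by rewrite !inE.
Qed.

Lemma bdryN n m (a : dhom m n) :
  ~ scmem (bdry n) (a : simplex n m) -> forall i, exists t, a t = i.
Proof.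
move=> h i; apply: contrapT => k; apply: h; apply/bdryP; exists i => t.
by apply/negP => /eqP e; apply: k; exists t.
Qed.

Lemma dhom_le m n (a : dhom m n) (i j : 'I_m.+1) : a i < a j -> i < j.
Proof. by rewrite !ltnNge; apply: contra => /(dhom_homo a). Qed.

Lemma dhom_bdry_factor n m (a : dhom m n) : scmem (bdry n) (a : simplex n m) ->
  exists n', n' < n /\ exists (d : dhom n' n) (a' : dhom m n'), a = dcomp d a'.
Proof.
move=> /bdryP[i hi].
case: n a i hi => [|n] a i hi.
  by have := hi ord0; rewrite (ord1 (a ord0)) (ord1 i) eqxx.
exists n; split=> //.
have dP (j k : 'I_n.+1) : j <= k -> lift i j <= lift i k by rewrite /= leq_bump2.
(* The default [ord0] is never taken, because [a] avoids [i]. *)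
pose g j := odflt ord0 (unlift i (a j)).
have gE j : lift i (g j) = a j.
  have h : i != a j by rewrite eq_sym.
  by case: (unlift_some h) => k e e'; rewrite /g e' -e.
have gP (j k : 'I_m.+1) : j <= k -> g j <= g k.
  move=> jk; rewrite -(leq_bump2 i).
  by have := dhom_homo a jk; rewrite -!gE /=.
exists (mkdhom dP), (mkdhom gP); apply: dhomP => j.
by rewrite dcompE !mkdhomE gE.
Qed.

(** A simplex outside the boundary is a surjection, and any choice of preimages is monotone.
    Prescribing that the section pass through [t] is what later lets sections tell two surjections
    apart. *)
Lemma dhom_section n m (a : dhom m n) (t : 'I_m.+1) :
  ~ scmem (bdry n) (a : simplex n m) ->
  exists s : dhom n m, dcomp a s = did n /\ s (a t) = t.
Proof.
move=> /bdryN sur.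
pose s k := if k == a t then t else proj1_sig (cid (sur k)).
have sE k : a (s k) = k.
  by rewrite /s; case: eqP => [->//|_]; apply: (proj2_sig (cid (sur k))).
have sP (i j : 'I_n.+1) : i <= j -> s i <= s j.
  rewrite leq_eqVlt => /orP[/eqP/val_inj ->//|h].
  by apply: ltnW; apply: (@dhom_le _ _ a); rewrite !sE.
exists (mkdhom sP); split; last by rewrite mkdhomE /s eqxx.
by apply: dhomP => i; rewrite dcompE !mkdhomE sE.
Qed.

Lemma dhom_endo_surj n (a : dhom n n) :
  ~ scmem (bdry n) (a : simplex n n) -> a = did n.
Proof.
move=> /bdryN sur.
have inj : injective a.
  have : {in [set: 'I_n.+1] &, injective a}.
    apply/image_injP; apply/eqP/eq_card => x.
    apply/idP/idP; first by rewrite !inE.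
    by move=> _; have [t <-] := sur x; apply: image_f; rewrite inE.
  by move=> h x y; apply: h; rewrite inE.
apply: dhomP => i; rewrite mkdhomE; apply: val_inj => /=.
(* Strong induction on [i]: if [a i < i], then [a] fixes [a i] and injectivity is violated; and the
   preimage of [i] is not below [i], since smaller elements are fixed, which bounds [a i] by [i]. *)
have [k] := ubnP i; elim: k i => // k IH i ik.
have ge : i <= a i.
  rewrite leqNgt; apply/negP => h.
  have lt : a i < k by apply: leq_trans h _; rewrite -ltnS.
  by have /val_inj/inj e := IH (a i) lt; rewrite e ltnn in h.
apply/eqP; rewrite eqn_leq ge andbT.
have [j e] := sur i.
have [ji|ij] := ltnP j i.
  have jk : j < k by apply: leq_trans ji _; rewrite -ltnS.
  by have := IH j jk; rewrite e => eij; rewrite eij ltnn in ji.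
by rewrite -[X in _ <= X](congr1 val e); apply: dhom_homo.
Qed.

(** A simplex [x] of least dimension outside [T] works. Its boundary lies in [T] by minimality,
    while along a surjection [a] the simplex [x] is recovered from [sact a x] by a section. The
    clauses say that [x] can be attached to [T] along its boundary, as [partial_lift_glue]
    requires. *)
Lemma minimal_cell (B : sSet) (T : subcpx B) :
    (exists n (x : B n), ~ scmem T x) ->
  exists n (x : B n), [/\ ~ scmem T x,
    forall m (a : dhom m n), scmem T (sact a x) <-> scmem (bdry n) (a : simplex n m) &
    forall m (a b : dhom m n), sact a x = sact b x -> ~ scmem T (sact a x) -> a = b].
Proof.
move=> [n0 [x0 hx0]].
have ex : exists n, `[< exists x : B n, ~ scmem T x >].
  by exists n0; apply/asboolP; exists x0.
case: (ex_minnP ex) => n /asboolP[x hx] nmin; exists n, x.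
have inT m (a : dhom m n) : scmem (bdry n) (a : simplex n m) -> scmem T (sact a x).
  case/dhom_bdry_factor => n' [ltn' [d [a' ->]]].
  rewrite sact_comp; apply: sc_act; apply: contrapT => h.
  have : n <= n' by apply: nmin; apply/asboolP; exists (sact d x).
  by rewrite leqNgt ltn'.
have inTE m (a : dhom m n) : scmem T (sact a x) <-> scmem (bdry n) (a : simplex n m).
  split; last exact: inT.
  move=> h; apply: contrapT => k; apply: hx.
  have [s [sa _]] := dhom_section ord0 k.
  by rewrite -(sact_id x) -sa sact_comp; apply: sc_act.
split => // m a b ab h.
have ka : ~ scmem (bdry n) (a : simplex n m) by move/inTE.
apply: dhomP => t; have [s [sa st]] := dhom_section t ka.
(* The endomorphism [dcomp b s] fixes [x], which is outside [T], so it is surjective and hence the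
   identity; evaluating at [a t], where [s] takes the value [t], gives [b t = a t]. *)
have : dcomp b s = did n.
  apply: dhom_endo_surj => /inT; rewrite sact_comp -ab -sact_comp sa sact_id.
  exact: hx.
move=> /(congr1 (fun c : dhom n n => c (a t))).
by rewrite dcompE mkdhomE st.
Qed.

(** * The prism *)

Lemma dnat_subproof m n (g : nat -> nat) (i j : 'I_m.+1) :
  (forall i j, i <= j -> j <= m -> g i <= g j <= n) -> i <= j ->
  (inord (g i) : 'I_n.+1) <= (inord (g j) : 'I_n.+1).
Proof.
move=> h ij; have /andP[le1 le2] := h i j ij (ltn_ord j).
by rewrite !inordK ?ltnS // (leq_trans le1).
Qed.

Definition dnat m n (g : nat -> nat)
    (h : forall i j, i <= j -> j <= m -> g i <= g j <= n) : dhom m n :=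
  mkdhom (fun i j => @dnat_subproof m n g i j h).

Lemma dnatE m n g h (i : 'I_m.+1) : @dnat m n g h i = g i :> nat.
Proof.
rewrite mkdhomE inordK // ltnS.
by case/andP: (h i i (leqnn i) (ltn_ord i)).
Qed.

Lemma prism_deg_subproof n k (i j : nat) : k <= n -> i <= j -> j <= n.+1 ->
  i - (k < i) <= j - (k < j) <= n.
Proof. by lia. Qed.

Lemma prism_step_subproof n k (i j : nat) : i <= j -> j <= n.+1 ->
  (k < i : nat) <= (k < j : nat) <= 1.
Proof. by lia. Qed.

(** The top-dimensional simplex of the prism along the path (0,0), ..., (k,0), (k,1), ..., (n,1).
    The function [i - (k < i)] is the codegeneracy that takes the value [k] twice. *)
Definition prism_simplex n k (kn : k <= n) :
    smap (simplex n.+1) (sprod (simplex n) (simplex 1)) :=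
  @yoneda (sprod (simplex n) (simplex 1)) n.+1
    (@dnat n.+1 n (fun i => i - (k < i)) (fun i j => @prism_deg_subproof n k i j kn),
     @dnat n.+1 1 (fun i => k < i) (@prism_step_subproof n k)).

Lemma prism_simplexE1 n k (kn : k <= n) m (c : dhom m n.+1) t :
  (prism_simplex kn m c).1 t = c t - (k < c t) :> nat.
Proof. by have := dnatE (fun i j => @prism_deg_subproof n k i j kn) (c t); rewrite -dcompE. Qed.

Lemma prism_simplexE2 n k (kn : k <= n) m (c : dhom m n.+1) t :
  (prism_simplex kn m c).2 t = (k < c t) :> nat.
Proof. by have := dnatE (@prism_step_subproof n k) (c t); rewrite -dcompE. Qed.

Lemma prism_filtration_subproof n k m l (a : dhom m l)
    (x : sprod (simplex n) (simplex 1) l) :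
  scmem (bdry n) x.1 \/ (forall t, 0 < x.2 t -> k <= x.1 t) ->
  scmem (bdry n) (sact a x).1 \/ (forall t, 0 < (sact a x).2 t -> k <= (sact a x).1 t).
Proof.
case=> h; [left; exact: sc_act|right=> t].
by rewrite !dcompE; apply: h.
Qed.

(* The prism simplices with index at least [k], together with the start and
   the sides of the prism. *)
Definition prism_filtration n k : subcpx (sprod (simplex n) (simplex 1)) :=
  SubCpx (@prism_filtration_subproof n k).

(** The face opposite [j] lies over the boundary of the base if [j < k] (it misses [j]) or
    [j > k.+1] (it misses [j.-1]). The face opposite [k.+1] skips (k,1) and so belongs to the next
    stage. Only the face opposite [k] is missing. *)
Lemma prism_horn n k (kn : k <= n) :
  sc_preim (prism_simplex kn) (prism_filtration n k.+1) = horn (inord k : 'I_n.+2).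
Proof.
have ks : k < n.+2 by lia.
apply: subcpxP => m c; split.
- case=> [/bdryP[i hi]|h].
  + have jn : (if i < k then i : nat else i.+1) < n.+2 by have := ltn_ord i; case: ifP; lia.
    exists (Ordinal jn); first by rewrite -val_eqE /= inordK //; case: ifP; lia.
    move=> t; rewrite !inE; apply/negP => /eqP e.
    have /eqP := hi t; apply; apply: val_inj; have := prism_simplexE1 kn c t; rewrite e /= => ->; case: ifP; lia.
  + have jn : k.+1 < n.+2 by lia.
    exists (Ordinal jn); first by rewrite -val_eqE /= inordK //; lia.
    move=> t; rewrite !inE; apply/negP => /eqP e.
    by have := h t; rewrite prism_simplexE1 prism_simplexE2 e /=; lia.
- case=> j; rewrite -val_eqE /= inordK // => jk h.
  have {}h t : c t != j :> nat by have := h t; rewrite !inE -val_eqE.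
  have [e|ne] := eqVneq (j : nat) k.+1.
    by right=> t; rewrite (prism_simplexE1 kn) (prism_simplexE2 kn); have := h t; rewrite e; lia.
  have jn : (if j < k then j : nat else j.-1) < n.+1 by case: ifP; have := ltn_ord j; lia.
  left; apply/(@bdryP n m (prism_simplex kn m c).1); exists (Ordinal jn) => t.
  apply/negP => /eqP e; have := prism_simplexE1 kn c t; rewrite e /=; have := h t; case: ifP; lia.
Qed.

Lemma prism_simplex_inj n k (kn : k <= n) m (c c' : simplex n.+1 m) :
  prism_simplex kn m c = prism_simplex kn m c' -> c = c'.
Proof.
move=> e; apply: dhomP => t; apply: val_inj.
have := congr1 (fun d : sprod (simplex n) (simplex 1) m => d.1 t : nat) e.
have := congr1 (fun d : sprod (simplex n) (simplex 1) m => d.2 t : nat) e.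
by rewrite !prism_simplexE1 !prism_simplexE2 /=; lia.
Qed.

(** A simplex of stage [k] outside stage [k.+1] passes through (k,1). By monotonicity its vertices
    on level 0 have first coordinate at most [k], those on level 1 at least [k], so the sum of the
    two coordinates factors it through the prism simplex. *)
Lemma prism_filtration_step n k (kn : k <= n) m (z : sprod (simplex n) (simplex 1) m) :
  scmem (prism_filtration n k) z <->
  scmem (prism_filtration n k.+1) z \/ exists c, prism_simplex kn m c = z.
Proof.
case: z => a b; split; last first.
  case=> [[h|h]|[c <-]].
  - by left.
  - by right=> t /h /ltnW.
  - by right=> t; rewrite (prism_simplexE1 kn) (prism_simplexE2 kn); lia.
case=> [h|h]; first by left; left.
have [h'|h'] := pselect (scmem (bdry n) (a : simplex n m)); first by left; left.
have [h1|h1] := pselect (forall t, 0 < b t -> k < a t); first by left; right.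
right.
have [t0 [bt0 at0]] : exists t0, 0 < b t0 /\ a t0 = k :> nat.
  apply: contrapT => no; apply: h1 => t bt; rewrite ltn_neqAle h // andbT.
  by apply/eqP => e; apply: no; exists t.
have cP (i j : 'I_m.+1) : i <= j -> (inord (a i + b i) : 'I_n.+2) <= (inord (a j + b j) : 'I_n.+2).
  move=> ij; have := dhom_homo a ij; have := dhom_homo b ij.
  have := ltn_ord (a i); have := ltn_ord (b i).
  have := ltn_ord (a j); have := ltn_ord (b j).
  by move=> *; rewrite !inordK; lia.
exists (mkdhom cP).
have ab t : (b t = 0 :> nat) -> a t <= k.
  move=> bt; have : t < t0 by apply: (@dhom_le _ _ b); rewrite bt.
  by move=> /ltnW /(dhom_homo a); rewrite at0.
have cE t : mkdhom cP t = a t + b t :> nat.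
  by rewrite mkdhomE inordK //; have := ltn_ord (a t); have := ltn_ord (b t); lia.
congr pair; apply: dhomP => t; apply: val_inj;
  have := prism_simplexE1 kn (mkdhom cP) t;
  have := prism_simplexE2 kn (mkdhom cP) t; rewrite cE;
  have := ltn_ord (b t); have := ab t; have := h t => /=; lia.
Qed.

Program Definition cyl (B : sSet) (S : subcpx B) : subcpx (sprod B (simplex 1)) :=
  @SubCpx (sprod B (simplex 1)) (fun n x => scmem S x.1 \/ x.2 = dconst n ord0) _.
Next Obligation.
case: H => [h|->]; first by left; apply: sc_act.
by right; rewrite dcomp_const.
Qed.

Lemma dhom1_const0 n (b : dhom n 1) : b = dconst n ord0 <-> forall t, ~~ (0 < b t).
Proof.
split=> [-> t|h]; first by rewrite mkdhomE.
by apply: dhomP => t; rewrite mkdhomE; apply: val_inj; have := h t; rewrite -eqn0Ngt => /eqP.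
Qed.

Lemma cyl_bdry n : cyl (bdry n) = prism_filtration n n.+1.
Proof.
apply: subcpxP => m [a b]; split=> -[h|h]; [by left| |by left|].
  by rewrite /= in h; right=> t; rewrite /= h mkdhomE.
right; apply/dhom1_const0 => t; apply/negP => /h /=.
by have := ltn_ord (a t); lia.
Qed.

(** * Lifting Kan fibrations against cylinders, and lifting against cells *)

Section KanFibrations.
Variables (E D : sSet) (p : smap E D).
Hypothesis kan_p : kan_fibration p.

(** The prism is filled by its top simplices from index [n] down to 0, each attached along a
    horn. *)
Lemma kan_prism n : has_rlp (sc_incl (cyl (bdry n))) p.
Proof.
apply: extend_rlp => b G0 G0p domG0; rewrite cyl_bdry in domG0.
have fil k : k <= n.+1 -> exists G, [/\ partial_lift p b G,
    forall m (z : sprod (simplex n) (simplex 1) m) (y : E m), graph_at G0 z y -> graph_at G z y &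
    gdom G = prism_filtration n (n.+1 - k)].
  elim: k => [|k IH] kn; first by exists G0; rewrite subn0.
  have [G [Gp G0G domG]] := IH (ltnW kn).
  have kn' : n - k <= n by rewrite leq_subr.
  have e : n.+1 - k = (n - k).+1 by lia.
  have [||G' [G'p GG' domG']] := partial_lift_glue (phi := prism_simplex kn') Gp.
  - by move=> m c c' /prism_simplex_inj.
  - by rewrite domG e prism_horn; apply: kan_p.
  exists G'; split=> //; first by move=> m z y /G0G; apply: GG'.
  rewrite subSS; apply: subcpxP => m z.
  by rewrite domG' domG e (prism_filtration_step kn').
have [G [Gp G0G domG]] := fil n.+1 (leqnn _).
have [|l lb lG] := partial_lift_total Gp.
  by move=> m z; rewrite domG subnn; right.
by exists l => // m z y /G0G; apply: lG.
Qed.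

(** Cells of [B] times the interval are attached one at a time. The invariant [Q] keeps the domain
    of the form B x 0 u T x I, so that a minimal cell outside [T] is attached along the domain of
    [kan_prism]. *)
Lemma kan_cyl (B : sSet) (S : subcpx B) : has_rlp (sc_incl (cyl S)) p.
Proof.
apply: extend_rlp => b G0 G0p domG0.
pose Q (G : subcpx (sprod (sprod B (simplex 1)) E)) := forall n (x : B n) (d : dhom n 1),
  @scmem _ (gdom G) n (x, d) -> d = dconst n ord0 \/
  forall d', @scmem _ (gdom G) n (x, d').
have G0Q : Q G0.
  move=> n x d; rewrite domG0 => -[/= h|/= ->]; last by left.
  by right=> d'; left.
apply: (partial_lift_zorn (Q := Q)) => //.
  move=> I F P FQ n x d [y [i Pi iy]].
  have [|->|h] := FQ i Pi n x d; [by exists y|by left|right=> d'].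
  by have [y' y'P] := h d'; exists y', i.
move=> G Gp GQ G0G [n0 [[x0 d0] hx0]].
have dom0 n (x : B n) : @scmem _ (gdom G) n (x, dconst n ord0).
  have : @scmem _ (gdom G0) n (x, dconst n ord0) by rewrite domG0; right.
  by case=> y /G0G yP; exists y.
have TP m n (a : dhom m n) (x : B n) :
    (forall d, @scmem _ (gdom G) n (x, d)) ->
    (forall d, @scmem _ (gdom G) m (sact a x, d)).
  move=> h d.
  (* The point at the end of the interval is in the domain and is not at the start, so [Q] puts the
     whole interval over [sact a x] into the domain. *)
  have := sc_act a (h (dconst n ord_max)); rewrite /= dcomp_const => /GQ[e|]; last exact.
  by have := congr1 (fun c : dhom m 1 => c ord0 : nat) e; rewrite !mkdhomE.
pose T := SubCpx TP.
have [|n [x [hx bd inj]]] := @minimal_cell B T.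
  by exists n0, x0 => /(_ d0).
pose phi := @SMap (sprod (simplex n) (simplex 1)) (sprod B (simplex 1))
  (fun m z => (sact z.1 x, z.2)) (fun m l a z => congr1 (pair^~ _) (sact_comp z.1 a x)).
have domphi : sc_preim phi (gdom G) = cyl (bdry n).
  apply: subcpxP => m [a d]; split.
    by move=> /GQ[e|h]; [right|left; apply/bd].
  by case=> /= [/bd h|->]; [apply: h|apply: dom0].
have [||G' [G'p GG' domG']] := partial_lift_glue (phi := phi) Gp.
- move=> m [a d] [a' d'] [e <-] h; congr pair.
  by apply: inj => // h'; apply: h; apply: h'.
- by rewrite domphi; apply: kan_prism.
have domGG' m z : @scmem _ (gdom G) m z -> scmem (gdom G') z by move=> h; apply/domG'; left.
exists G'; split=> //.
- move=> m x' d /domG'[/GQ[->|h]|[[a d'] [<- _]]]; first by left.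
    by right=> d'; apply: domGG'.
  by right=> d''; apply/domG'; right; exists (a, d'').
- have [d hd] : exists d, ~ @scmem _ (gdom G) n (x, d).
    by apply: contrapT => h; apply: hx => d; apply: contrapT => h'; apply: h; exists d.
  exists n, (x, d); split=> //; apply/domG'; right; exists (did n, d).
  by rewrite /= sact_id.
Qed.

End KanFibrations.

Definition boundary_rlp (E D : sSet) (p : smap E D) : Prop :=
  forall n, has_rlp (sc_incl (bdry n)) p.

(** Every simplicial set is obtained from a subcomplex by attaching minimal cells, each along its
    boundary. *)
Lemma boundary_rlp_sub (E D : sSet) (p : smap E D) : boundary_rlp p ->
  forall (B : sSet) (S : subcpx B), has_rlp (sc_incl S) p.
Proof.
move=> rlp B S; apply: extend_rlp => b G0 G0p domG0.
apply: (partial_lift_zorn (Q := fun=> True)) => //.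
move=> G Gp _ G0G /minimal_cell[n [x [hx bd inj]]].
have [||G' [G'p GG' domG']] := partial_lift_glue (phi := yoneda x) Gp.
- by move=> m; apply: inj.
- by have -> : sc_preim (yoneda x) (gdom G) = bdry n; [apply: subcpxP|apply: rlp].
exists G'; split=> //; exists n, x; split=> //.
by apply/domG'; right; exists (did n); rewrite /= sact_id.
Qed.

(** * Homotopies *)

Program Definition sfst (A B : sSet) : smap (sprod A B) A :=
  @SMap (sprod A B) A (fun n x => x.1) _.

Program Definition sprod_mapl (A A' B : sSet) (f : smap A A') :
    smap (sprod A B) (sprod A' B) :=
  @SMap (sprod A B) (sprod A' B) (fun n x => (f n x.1, x.2)) _.
Next Obligation. by rewrite smap_nat. Qed.

Program Definition cyl_end (A : sSet) (k : 'I_2) : smap A (sprod A (simplex 1)) :=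
  @SMap A (sprod A (simplex 1)) (fun n x => (x, dconst n k)) _.
Next Obligation. by rewrite dcomp_const. Qed.

Lemma dconst01 n : dconst n (ord0 : 'I_2) <> dconst n ord_max.
Proof. by move=> /(congr1 (fun d : dhom n 1 => d ord0 : nat)); rewrite !mkdhomE. Qed.

Program Definition cyl_ends (A : sSet) : subcpx (sprod A (simplex 1)) :=
  @SubCpx (sprod A (simplex 1))
    (fun n x => x.2 = dconst n ord0 \/ x.2 = dconst n ord_max) _.
Next Obligation. by case: H => ->; [left|right]; apply: dcomp_const. Qed.

Section GraphOfTwoMaps.
Variables (A E : sSet) (h0 h1 : smap A E).

Program Definition ends_graph : subcpx (sprod (sprod A (simplex 1)) E) :=
  @SubCpx (sprod (sprod A (simplex 1)) E)
    (fun n x => (x.1.2 = dconst n ord0 /\ x.2 = h0 n x.1.1) \/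
                (x.1.2 = dconst n ord_max /\ x.2 = h1 n x.1.1)) _.
Next Obligation.
by case: H => -[-> ->]; [left|right]; rewrite smap_nat dcomp_const.
Qed.

End GraphOfTwoMaps.

Lemma elem_homotopic_refl (A K : sSet) (g : smap A K) : elem_homotopic g g.
Proof. by exists (scomp g (sfst A (simplex 1))). Qed.

Lemma elem_homotopic_comp (A B K L : sSet) (u : smap A B) (v : smap K L) (g h : smap B K) :
  elem_homotopic g h -> elem_homotopic (scomp v (scomp g u)) (scomp v (scomp h u)).
Proof.
move=> [H H0 H1]; exists (scomp v (scomp H (sprod_mapl (simplex 1) u))) => n x /=.
  by rewrite H0.
by rewrite H1.
Qed.

Lemma homotopic_comp (A B K L : sSet) (u : smap A B) (v : smap K L) (g h : smap B K) :
  homotopic g h -> homotopic (scomp v (scomp g u)) (scomp v (scomp h u)).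
Proof.
elim=> [f k fk||f k _ IH|f k l _ IH1 _ IH2].
- by apply: rst_step; apply: elem_homotopic_comp.
- by move=> f; apply: rst_refl.
- exact: rst_sym.
- exact: rst_trans IH1 IH2.
Qed.

Lemma homotopic_pre (A B K : sSet) (u : smap A B) (g h : smap B K) :
  homotopic g h -> homotopic (scomp g u) (scomp h u).
Proof. by move/(homotopic_comp u (sidm K)); congr homotopic; apply: smapP. Qed.

Lemma homotopic_post (A K L : sSet) (v : smap K L) (g h : smap A K) :
  homotopic g h -> homotopic (scomp v g) (scomp v h).
Proof. by move/(homotopic_comp (sidm A) v); congr homotopic; apply: smapP. Qed.

Lemma scompA (A B C D : sSet) (h : smap C D) (g : smap B C) (f : smap A B) :
  scomp h (scomp g f) = scomp (scomp h g) f.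
Proof. exact: smapP. Qed.

Lemma scompId (A B : sSet) (f : smap A B) : scomp f (sidm A) = f.
Proof. exact: smapP. Qed.

Lemma scompdI (A B : sSet) (f : smap A B) : scomp (sidm B) f = f.
Proof. exact: smapP. Qed.

Section HomotopyLifting.
Variables (E D : sSet) (p : smap E D).
Hypothesis kan_p : kan_fibration p.

(** The relative homotopy lifting property: [g] prescribes the lift at the start, the graph [H]
    prescribes it on S x I, and together they form a partial lift on [cyl S]. *)
Lemma kan_homotopy_lifting (B : sSet) (S : subcpx B) (b : smap (sprod B (simplex 1)) D)
    (g : smap B E) (H : subcpx (sprod (sprod B (simplex 1)) E)) :
    scomp p g = scomp b (cyl_end B ord0) ->
    partial_lift p b H ->
    (forall n (x : B n) v, @scmem _ (gdom H) n (x, v) <-> scmem S x) ->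
    (forall n (x : B n) y, @graph_at _ _ H n (x, dconst n ord0) y -> y = g n x) ->
  exists l : smap (sprod B (simplex 1)) E, [/\ scomp p l = b,
    scomp l (cyl_end B ord0) = g & forall n z y, graph_at H z y -> l n z = y].
Proof.
move=> gb [Hfun Hb] domH Hg.
have GP m n (a : dhom m n) (z : sprod (sprod B (simplex 1)) E n) :
    (z.1.2 = dconst n ord0 /\ z.2 = g n z.1.1) \/ graph_at H z.1 z.2 ->
    ((sact a z).1.2 = dconst m ord0 /\ (sact a z).2 = g m (sact a z).1.1) \/
    graph_at H (sact a z).1 (sact a z).2.
  case=> [[e1 e2]|/(graph_at_act a)]; last by right.
  by left; rewrite /= e1 e2 smap_nat dcomp_const.
have [||l lb lG] := rlp_extend (kan_cyl kan_p (S := S)) (b := b) (G := SubCpx GP).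
- split=> n [x v] y.
    move=> y' [[/= -> ->]|/= h] [[/= e' ->]|/= h'] //.
    + by rewrite (Hg _ _ _ h').
    + by rewrite e' in h; rewrite (Hg _ _ _ h).
    + exact: Hfun h h'.
  by case=> [[/= -> ->]|/= /Hb]; [exact: (smap_eqP gb)|].
- apply: subcpxP => n [x v]; split.
    case=> y [[/= -> _]|/= h]; first by right.
    by left; apply/(domH n x v); exists y.
  case=> /= [/(domH n x v)[y yP]|->]; first by exists y; right.
  by exists (g n x); left.
exists l; split=> //.
  by apply: smapP => n x /=; apply: lG; left.
by move=> n z y h; apply: lG; right.
Qed.

(** Fills a square of homotopies over [W] from three sides: [g] at the start of the second interval,
    [h0] and [h1] over the two ends of the first. Applications read off the fourth side, at the end
    of the second interval. *)
Lemma kan_square (A : sSet) (W : smap (sprod (sprod A (simplex 1)) (simplex 1)) D)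
    (g h0 h1 : smap (sprod A (simplex 1)) E) :
    (forall n x u, p n (g n (x, u)) = W n ((x, u), dconst n ord0)) ->
    (forall n x v, p n (h0 n (x, v)) = W n ((x, dconst n ord0), v)) ->
    (forall n x v, p n (h1 n (x, v)) = W n ((x, dconst n ord_max), v)) ->
    (forall n x, g n (x, dconst n ord0) = h0 n (x, dconst n ord0)) ->
    (forall n x, g n (x, dconst n ord_max) = h1 n (x, dconst n ord0)) ->
  exists l : smap (sprod (sprod A (simplex 1)) (simplex 1)) E,
    [/\ scomp p l = W, forall n x v, l n ((x, dconst n ord0), v) = h0 n (x, v) &
        forall n x v, l n ((x, dconst n ord_max), v) = h1 n (x, v)].
Proof.
move=> gW h0W h1W g0 g1.
have HP m n (a : dhom m n) (z : sprod (sprod (sprod A (simplex 1)) (simplex 1)) E n) :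
    (z.1.1.2 = dconst n ord0 /\ z.2 = h0 n (z.1.1.1, z.1.2)) \/
    (z.1.1.2 = dconst n ord_max /\ z.2 = h1 n (z.1.1.1, z.1.2)) ->
    ((sact a z).1.1.2 = dconst m ord0 /\ (sact a z).2 = h0 m ((sact a z).1.1.1, (sact a z).1.2)) \/
    ((sact a z).1.1.2 = dconst m ord_max /\ (sact a z).2 = h1 m ((sact a z).1.1.1, (sact a z).1.2)).
  by case=> -[/= e1 e2]; [left|right]; rewrite e1 e2 -smap_nat dcomp_const.
have [||||l [lW lg lH]] := @kan_homotopy_lifting (sprod A (simplex 1)) (cyl_ends A) W g (SubCpx HP).
- by apply: smapP => n [x u] /=.
- split=> n [[x u] v] y.
    move=> y' [[/= e ->]|[/= e ->]] [[/= e' ->]|[/= e' ->]] //.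
      by case: (@dconst01 n); rewrite -e -e'.
    by case: (@dconst01 n); rewrite -e -e'.
  by case=> -[/= -> ->].
- move=> n [x u] v; split; first by case=> y [[/= -> _]|[/= -> _]]; [left|right].
  case=> /= ->; first by exists (h0 n (x, v)); left.
  by exists (h1 n (x, v)); right.
- by move=> n [x u] y [[/= -> ->]|[/= -> ->]].
by exists l; split=> // n x v; apply: lH; [left|right].
Qed.

Lemma kan_lift_homotopy (B : sSet) (b : smap (sprod B (simplex 1)) D) (g : smap B E) :
    scomp p g = scomp b (cyl_end B ord0) ->
  exists l : smap (sprod B (simplex 1)) E, scomp p l = b /\ scomp l (cyl_end B ord0) = g.
Proof.
move=> gb.
pose S0 := @SubCpx B (fun _ _ => False) (fun _ _ _ _ h => h).
pose H := @SubCpx (sprod (sprod B (simplex 1)) E) (fun _ _ => False) (fun _ _ _ _ h => h).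
have [||||l [lb lg _]] := @kan_homotopy_lifting B S0 b g H => //.
  by move=> n x v; split=> // -[].
by exists l.
Qed.

End HomotopyLifting.

Lemma to_pt_eq (A : sSet) (f g : smap A spt) : f = g.
Proof. by apply: smapP => n x; case: (f n x); case: (g n x). Qed.

(** The two homotopies are the sides of a square whose start is constant at [g]; its fourth side
    joins [h] to [k]. With reflexivity, this form yields both symmetry and transitivity. *)
Lemma kan_elem_homotopic_euclid (A K : sSet) (g h k : smap A K) : kan_complex K ->
  elem_homotopic g h -> elem_homotopic g k -> elem_homotopic h k.
Proof.
move=> kanK [H1 H10 H11] [H2 H20 H21].
have [|||||l [_ l0 l1]] := @kan_square _ _ _ kanK A (to_pt _) (scomp g (sfst A (simplex 1))) H1 H2.
all: try by move=> n x /=.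
exists (scomp l (cyl_end (sprod A (simplex 1)) ord_max)) => n x /=.
  by rewrite l0 H11.
by rewrite l1 H21.
Qed.

Lemma kan_homotopic (A K : sSet) (g h : smap A K) : kan_complex K ->
  homotopic g h -> elem_homotopic g h.
Proof.
move=> kanK; elim=> {g h} [//|g|g h _ gh|g h k _ gh _ hk].
- exact: elem_homotopic_refl.
- exact: kan_elem_homotopic_euclid gh (elem_homotopic_refl g).
- apply: kan_elem_homotopic_euclid hk => //.
  exact: kan_elem_homotopic_euclid gh (elem_homotopic_refl g).
Qed.

(** * Weak equivalences and trivial fibrations *)

Lemma weq_comp (A B C : sSet) (f : smap A B) (g : smap B C) :
  weak_equivalence f -> weak_equivalence g -> weak_equivalence (scomp g f).
Proof.
move=> wf wg K kanK; have [fi fs] := wf K kanK; have [gi gs] := wg K kanK.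
split=> [h k|h]; first by rewrite !scompA => /fi /gi.
have [k hk] := fs h; have [l kl] := gs k; exists l.
by rewrite scompA; apply: rst_trans hk; apply: homotopic_pre.
Qed.

Lemma weq_cancel (A B C : sSet) (f : smap A B) (g : smap B C) :
  weak_equivalence g -> weak_equivalence (scomp g f) -> weak_equivalence f.
Proof.
move=> wg wgf K kanK; have [gi gs] := wg K kanK; have [gfi gfs] := wgf K kanK.
split=> [h k hk|h].
  have [h' hh] := gs h; have [k' kk] := gs k.
  apply: rst_trans (rst_sym _ _ _ _ hh) _; apply: rst_trans (kk).
  apply: homotopic_pre; apply: gfi; rewrite !scompA.
  apply: rst_trans (homotopic_pre f hh) _; apply: rst_trans hk _.
  exact: rst_sym (homotopic_pre f kk).
by have [k hk] := gfs h; exists (scomp k g); rewrite -scompA.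
Qed.

Lemma weq_iso (A B : sSet) (f : smap A B) (g : smap B A) :
  scomp g f = sidm A -> scomp f g = sidm B -> weak_equivalence f.
Proof.
move=> gf fg K kanK; split=> [h k /(homotopic_pre g)|h].
  by rewrite -!scompA fg !scompId.
by exists (scomp h g); rewrite -scompA gf scompId; apply: rst_refl.
Qed.

(** Lifting against the empty subcomplex of [D] gives a section [s]; lifting against the two ends of
    the cylinder on [E] gives a homotopy from [scomp s p] to the identity. So [p] is a homotopy
    equivalence. *)
Lemma boundary_rlp_weq (E D : sSet) (p : smap E D) :
  boundary_rlp p -> weak_equivalence p.
Proof.
move=> rlp.
pose S0 := @SubCpx D (fun _ _ => False) (fun _ _ _ _ h => h).
have [l0 _] : exists l : smap (sc_sset S0) E, True.
  have [l _] := @smap_unique_choice (sc_sset S0) E (fun _ _ _ => True)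
    (fun n x => match proj2_sig x with end)
    (fun n x => match proj2_sig x with end) (fun _ _ _ _ _ _ => I).
  by exists l.
have [|s _ ps] := boundary_rlp_sub rlp (S := S0) (a := l0) (b := sidm D).
  by apply: smapP => n [x []].
have sp n x : p n (s n x) = x by apply: (smap_eqP ps).
have [||k kp kG] := rlp_extend (boundary_rlp_sub rlp (S := cyl_ends E))
  (b := scomp p (sfst E (simplex 1))) (G := ends_graph (scomp s p) (sidm E)).
- split=> n [x u] y.
    move=> y' [[/= e ->]|[/= e ->]] [[/= e' ->]|[/= e' ->]] //.
      by case: (@dconst01 n); rewrite -e -e'.
    by case: (@dconst01 n); rewrite -e -e'.
  by case=> -[/= _ ->].
- apply: subcpxP => n [x u]; split.
    by case=> y [[/= -> _]|[/= -> _]]; [left|right].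
  by case=> /= ->; [exists (s n (p n x)); left|exists x; right].
have hk : elem_homotopic (scomp s p) (sidm E).
  by exists k => n x; apply: kG; [left|right].
move=> K kanK; split=> [g h /(homotopic_pre s)|g].
  by rewrite -!scompA ps !scompId.
exists (scomp g s); rewrite -scompA.
by have := homotopic_post g (rst_step _ _ _ _ hk); rewrite scompId.
Qed.

Lemma rlp_comp (A B E D F : sSet) (i : smap A B) (p : smap E D) (q : smap D F) :
  has_rlp i p -> has_rlp i q -> has_rlp i (scomp q p).
Proof.
move=> rp rq a b; rewrite -scompA => ab.
have [l li ql] := rq _ _ ab; have [k ki pk] := rp a l (esym li).
by exists k => //; rewrite -scompA pk.
Qed.

Lemma kan_fibration_total (E D : sSet) (p : smap E D) :
  kan_fibration p -> kan_complex D -> kan_complex E.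
Proof.
move=> kp kD n k n0; rewrite (to_pt_eq (to_pt E) (scomp (to_pt D) p)).
exact: rlp_comp (kp n k n0) (kD n k n0).
Qed.

(** Dold's argument. A homotopy inverse [s1] is obtained by testing the weak equivalence on [E] and
    [D]; lifting the homotopy from [scomp p s1] to the identity replaces it by a strict section [s].
    The homotopy from [scomp s p] to the identity is then made fibrewise, and a boundary problem is
    solved by transporting [scomp s c] along it. *)
Lemma boundary_rlp_of_weq (E D : sSet) (p : smap E D) :
  kan_fibration p -> kan_complex D -> weak_equivalence p -> boundary_rlp p.
Proof.
move=> kp kD wp; have kE := kan_fibration_total kp kD.
have [s1 s1p] := (wp E kE).2 (sidm E).
have ps1 : elem_homotopic (scomp p s1) (sidm D).
  apply: kan_homotopic => //; apply: (wp D kD).1; rewrite scompdI.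
  by have := homotopic_post p s1p; rewrite scompId scompA.
case: ps1 => b b0 b1.
have [|L [pL L0]] := kan_lift_homotopy kp (b := b) (g := s1).
  by apply: smapP => n x; rewrite /= b0.
pose s := scomp L (cyl_end D ord_max).
have ps : scomp p s = sidm D by rewrite /s scompA pL; apply: smapP => n x /=; rewrite b1.
have psx n x : p n (s n x) = x by apply: (smap_eqP ps).
have [h h0 h1] : elem_homotopic (scomp s p) (sidm E).
  apply: kan_homotopic => //; apply: rst_trans s1p.
  apply: homotopic_pre; apply: rst_sym; apply: rst_step.
  by exists L => n x //; apply: (smap_eqP L0).
(* The square over [p h] with sides [s p h] and [h] and constant start
   has a fibrewise homotopy from [s p] to the identity as its end. *)
have [|||||Q [pQ Q0 Q1]] := @kan_square _ _ p kp E
  (scomp (scomp p h) (sprod_mapl (simplex 1) (sfst E (simplex 1))))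
  (scomp (scomp s p) (sfst E (simplex 1))) (scomp (scomp s p) h) h => //=.
- by move=> n x u; rewrite h0.
- by move=> n x v; rewrite psx.
- by move=> n x; rewrite h0 /= psx.
have [k [k0 k1 pk]] : exists k : smap (sprod E (simplex 1)) E,
    [/\ forall n x, k n (x, dconst n ord0) = s n (p n x),
        forall n x, k n (x, dconst n ord_max) = x &
        forall n x v, p n (k n (x, v)) = p n x].
  exists (scomp Q (cyl_end (sprod E (simplex 1)) ord_max)); split=> n x /=.
  - by rewrite Q0 /= h1.
  - by rewrite Q1 h1.
  - by move=> v; have /= -> := smap_eqP pQ ((x, v), dconst n ord_max); rewrite h1.
move=> m a c ac.
(* Over the boundary the fibrewise homotopy [k] moves [scomp s p] applied to [a] back to [a].
   Extending it from the start [scomp s c] over the constant homotopy at [c] gives a solution at the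
   end of the cylinder. *)
have HP q r (d : dhom q r) (z : sprod (sprod (simplex m) (simplex 1)) E r) :
    (exists i : scmem (bdry m) z.1.1, z.2 = k r (a r (exist _ z.1.1 i), z.1.2)) ->
    (exists i : scmem (bdry m) (sact d z).1.1,
       (sact d z).2 = k q (a q (exist _ (sact d z).1.1 i), (sact d z).1.2)).
  case: z => [[x v] y] [i /= ->]; exists (@sc_act _ (bdry m) _ _ d x i).
  rewrite -smap_nat; apply: (congr1 (k q)); congr pair; rewrite /= -smap_nat; congr (a q _).
have [||||l [pl l0 lH]] := @kan_homotopy_lifting _ _ p kp (simplex m) (bdry m)
  (scomp c (sfst (simplex m) (simplex 1))) (scomp s c) (SubCpx HP).
- by apply: smapP => n x /=; rewrite psx.
- split=> n [x v] y.
    by move=> y' [/= i ->] [/= i' ->]; congr (k n (a n _, _)); apply: eq_exist.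
  by case=> /= i ->; rewrite pk; apply: (smap_eqP ac (exist _ x i)).
- move=> n x v; split; first by case=> y [].
  by move=> i; exists (k n (a n (exist _ x i), v)), i.
- move=> n x y [/= i ->]; rewrite k0; congr (s n _).
  exact: (smap_eqP ac (exist _ x i)).
exists (scomp l (cyl_end (simplex m) ord_max)).
  by apply: smapP => n [x i] /=; rewrite -[RHS]k1; apply: lH; exists i.
by rewrite scompA pl; apply: smapP.
Qed.

(** * Monomorphisms, extensionality and bijections *)

Ltac pointwise e := apply: smapP => ? ?; exact: (smap_eqP e).

Lemma inj_smono (A B : sSet) (u : smap A B) : (forall n, injective (u n)) -> smono u.
Proof.
move=> inj C g h gh; apply: smapP => n x; apply: inj.
exact: (smap_eqP gh).
Qed.

Lemma sc_sset_ext (A C : sSet) (S : subcpx A) (g h : smap C (sc_sset S)) :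
  scomp (sc_incl S) g = scomp (sc_incl S) h -> g = h.
Proof.
move=> gh; apply: smapP => n c; have /= := smap_eqP gh c.
by case: (g n c) (h n c) => x hx [y hy] /=; apply: eq_exist.
Qed.

Lemma spull_ext (A B C Z : sSet) (f : smap A C) (g : smap B C)
    (h k : smap Z (spull f g)) :
  scomp (spull_fst f g) h = scomp (spull_fst f g) k ->
  scomp (spull_snd f g) h = scomp (spull_snd f g) k -> h = k.
Proof.
move=> e1 e2; apply: smapP => n c; have /= := smap_eqP e1 c; have /= := smap_eqP e2 c.
case: (h n c) (k n c) => [[x y] hx] [[x' y'] hx'] /= ey ex; apply: eq_exist.
by rewrite ex ey.
Qed.

Lemma smap_bij_iso (A B : sSet) (j : smap A B) :
    (forall n, injective (j n)) -> (forall n y, exists x, j n x = y) ->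
  exists2 k : smap B A, scomp k j = sidm A & scomp j k = sidm B.
Proof.
move=> inj sur.
have [|||k kP] := @smap_unique_choice B A (fun n y x => j n x = y).
- exact: sur.
- by move=> n y x x' <- /inj.
- by move=> m n a y x /= <-; rewrite smap_nat.
exists k; apply: smapP => n x /=; last exact: kP.
by apply: inj; rewrite kP.
Qed.

(** * Restriction maps of mapping complexes *)

Lemma bslash_res_comp (A B C : sSet) (u : smap A B) (v : smap B C) (X : bsSet) :
  bslash_res (scomp v u) X = scomp (bslash_res u X) (bslash_res v X).
Proof. by apply: smapP => n phi; apply: bmapP. Qed.

Lemma bslash_bpt_eq (A Z : sSet) (g h : smap Z (bslash A bpt)) : g = h.
Proof.
apply: smapP => n z; apply: bmapP => k l x.
by case: (g n z k l x); case: (h n z k l x).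
Qed.

Program Definition to_bslash_bpt (A Z : sSet) : smap Z (bslash A bpt) :=
  @SMap Z (bslash A bpt) (fun n _ => to_bpt _) _.
Next Obligation. exact: bmapP. Qed.

(** The gap condition over [bpt], where all mapping complexes are points, is a condition on the
    restriction map alone. *)
Lemma bslash_res_kan (X : bsSet) (A A' : sSet) (u : smap A A') :
  reedy_fibrant X -> smono u -> kan_fibration (bslash_res u X).
Proof.
move=> rX mu n k n0 a b ab.
have H : scomp (bslash_push A (to_bpt X)) b =
         scomp (bslash_res u bpt) (to_bslash_bpt A' _) by apply: bslash_bpt_eq.
have [|l la lb] := rX _ _ u mu n k n0 a (spull_pair H).
  by apply: spull_ext; [pointwise ab|apply: bslash_bpt_eq].
exists l => //.
by have h := congr1 (scomp (spull_fst _ _)) lb; pointwise h.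
Qed.

Definition sempty : sSet :=
  @SSet (fun=> False) (fun _ _ _ x => x) (fun _ _ => erefl) (fun _ _ _ _ _ _ => erefl).

(** Restriction along the inclusion of the empty simplicial set is a Kan fibration onto a point. *)
Lemma bslash_kan (X : bsSet) (A : sSet) : reedy_fibrant X -> kan_complex (bslash A X).
Proof.
move=> rX.
pose u := @SMap sempty A (fun _ x => match x with end) (fun _ _ _ x => match x with end).
have eX (Z : sSet) (g h : smap Z (bslash sempty X)) : g = h.
  by apply: smapP => n z; apply: bmapP => p q [[]].
have bX (Z : sSet) : exists g : smap Z (bslash sempty X), True.
  pose b n := @BMap (box sempty (simplex n)) X (fun m l x => match x.1 with end)
    (fun _ _ _ _ _ _ x => match x.1 with end).
  have bn m n (a : dhom m n) (x : Z n) : b m = @sact (bslash sempty X) _ _ a (b n).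
    by apply: bmapP => p q [[]].
  by exists (@SMap Z (bslash sempty X) (fun n _ => b n) bn).
move=> n k n0 a b ab; have [c _] := bX (simplex n).
have [|l la _] := @bslash_res_kan X _ _ u rX _ n k n0 a c (eX _ _ _).
  by apply: inj_smono => m [].
by exists l => //; apply: to_pt_eq.
Qed.

Program Definition sc_vertex (A : sSet) (v : A 0) : subcpx A :=
  @SubCpx A (fun n x => x = sact (dconst n ord0) v) _.
Next Obligation. by rewrite H -sact_comp dcomp_const. Qed.

Lemma kan_fiber (E D : sSet) (p : smap E D) (v : D 0) : kan_fibration p ->
  kan_complex (sc_sset (sc_preim p (sc_vertex v))).
Proof.
move=> kp n k n0 a b ab.
have [|l la lb] := kp n k n0 (scomp (sc_incl _) a) (scomp (pt_incl v) (to_pt _)).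
  by apply: smapP => m x /=; case: (a m x).
have lP m x : scmem (sc_preim p (sc_vertex v)) (l m x) by apply: (smap_eqP lb).
exists (sc_lift lP); last exact: to_pt_eq.
by apply: sc_sset_ext; rewrite -la; apply: smapP.
Qed.

(** * Lifting for gap maps *)

Section GapMaps.
Variables (X Y : bsSet) (f : bmap X Y).

Section Gap.
Variables (A A' : sSet) (u : smap A A') (M : subcpx (bslash A X)).

(** Gap maps are restricted to a subcomplex [M] of A\X. Taking [M] full or a strict fiber over [e]
    covers the absolute gap map and the one over [e] at once. *)
Definition gap_cod : subcpx (spull (bslash_push A f) (bslash_res u Y)) :=
  sc_preim (spull_fst _ _) M.

Program Definition gap_over : smap (sc_sset (sc_preim (bslash_gap u f) gap_cod)) (sc_sset gap_cod) :=
  @sc_lift _ _ gap_cod (scomp (bslash_gap u f) (sc_incl _)) _.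
Next Obligation. exact: (proj2_sig c). Qed.

(** The lifting problem against [gap_over] with its fiber products unpacked into components;
    [gap_liftsP] is the equivalence. *)
Definition gap_lifts (C C' : sSet) (i : smap C C') : Prop :=
  forall (a : smap C (bslash A' X)) (phi : smap C' (bslash A X)) (psi : smap C' (bslash A' Y)),
    scomp (bslash_res u X) a = scomp phi i ->
    scomp (bslash_push A' f) a = scomp psi i ->
    scomp (bslash_push A f) phi = scomp (bslash_res u Y) psi ->
    (forall n c, scmem M (phi n c)) ->
  exists l : smap C' (bslash A' X), [/\ scomp l i = a,
    scomp (bslash_res u X) l = phi & scomp (bslash_push A' f) l = psi].

Definition gap_fst : smap (sc_sset gap_cod) (bslash A X) := scomp (spull_fst _ _) (sc_incl _).
Definition gap_snd : smap (sc_sset gap_cod) (bslash A' Y) := scomp (spull_snd _ _) (sc_incl _).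

Lemma gap_cod_ext (C : sSet) (g h : smap C (sc_sset gap_cod)) :
  scomp gap_fst g = scomp gap_fst h -> scomp gap_snd g = scomp gap_snd h -> g = h.
Proof.
by move=> e1 e2; apply: sc_sset_ext; apply: spull_ext; [pointwise e1|pointwise e2].
Qed.

Lemma gap_cod_pair (C : sSet) (phi : smap C (bslash A X)) (psi : smap C (bslash A' Y)) :
    scomp (bslash_push A f) phi = scomp (bslash_res u Y) psi ->
    (forall n c, scmem M (phi n c)) ->
  exists g : smap C (sc_sset gap_cod), scomp gap_fst g = phi /\ scomp gap_snd g = psi.
Proof.
move=> H hM.
have hP n c : scmem gap_cod (spull_pair H n c) by apply: hM.
by exists (sc_lift hP); split; apply: smapP.
Qed.

Lemma gap_cod_sq (C : sSet) (g : smap C (sc_sset gap_cod)) :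
  scomp (bslash_push A f) (scomp gap_fst g) = scomp (bslash_res u Y) (scomp gap_snd g).
Proof. by apply: smapP => n c; apply: (proj2_sig (proj1_sig (g n c))). Qed.

Lemma gap_liftsP (C C' : sSet) (i : smap C C') :
  gap_lifts i <-> has_rlp i gap_over.
Proof.
split.
- move=> L a b ab.
  have [||||l [li lphi lpsi]] := L (scomp (sc_incl _) a) (scomp gap_fst b) (scomp gap_snd b).
  + by have h := congr1 (scomp gap_fst) ab; pointwise h.
  + by have h := congr1 (scomp gap_snd) ab; pointwise h.
  + exact: gap_cod_sq.
  + by move=> n c; apply: (proj2_sig (b n c)).
  have lP n c : scmem (sc_preim (bslash_gap u f) gap_cod) (l n c).
    by have /= := smap_eqP lphi c => h; rewrite /= h; apply: (proj2_sig (b n c)).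
  exists (sc_lift lP).
    by apply: sc_sset_ext; pointwise li.
  apply: gap_cod_ext; first by pointwise lphi.
  by pointwise lpsi.
- move=> L a phi psi aphi apsi H hM.
  have [g [g1 g2]] := gap_cod_pair H hM.
  have aP n c : scmem (sc_preim (bslash_gap u f) gap_cod) (a n c).
    by have /= := smap_eqP aphi c => h; rewrite /= h; apply: hM.
  have [|l la lg] := L (sc_lift aP) g.
    apply: gap_cod_ext.
      by rewrite [RHS]scompA g1; pointwise aphi.
    by rewrite [RHS]scompA g2; pointwise apsi.
  exists (scomp (sc_incl _) l); split.
  + by rewrite -scompA la; apply: smapP.
  + by rewrite -g1 -lg; apply: smapP.
  + by rewrite -g2 -lg; apply: smapP.
Qed.

Lemma rlp_gap_lifts (C C' : sSet) (i : smap C C') :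
  has_rlp i (bslash_gap u f) -> gap_lifts i.
Proof.
move=> L a phi psi aphi apsi H _.
have [|l la lg] := L a (spull_pair H).
  by apply: spull_ext; [pointwise aphi|pointwise apsi].
exists l; split=> //.
  by have h := congr1 (scomp (spull_fst _ _)) lg; pointwise h.
by have h := congr1 (scomp (spull_snd _ _)) lg; pointwise h.
Qed.

Definition gap_trivial : Prop := forall n, gap_lifts (sc_incl (bdry n)).

Lemma gap_trivialP : gap_trivial <-> boundary_rlp gap_over.
Proof. by split=> h n; apply/gap_liftsP; apply: h. Qed.

Hypothesis reedy_f : reedy_fibration f.

Lemma gap_over_kan : smono u -> kan_fibration gap_over.
Proof.
by move=> mu n k n0; apply/gap_liftsP; apply: rlp_gap_lifts; apply: reedy_f.
Qed.

(** The projection of [gap_cod] to [M] is a base change of the Kan fibration A'\Y -> A\Y, so horns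
    are filled first in [M] and then in A'\Y. *)
Lemma gap_cod_kan : smono u -> reedy_fibrant Y -> kan_complex (sc_sset M) ->
  kan_complex (sc_sset gap_cod).
Proof.
move=> mu rY kM n k n0 a b _.
have aP m c : scmem M (scomp gap_fst a m c) by apply: (proj2_sig (a m c)).
have [|phi phia _] := kM n k n0 (sc_lift aP) b; first exact: to_pt_eq.
have [|psi psia psib] := bslash_res_kan rY mu n0 (k := k) (a := scomp gap_snd a)
    (b := scomp (bslash_push A f) (scomp (sc_incl M) phi)).
  by rewrite -gap_cod_sq -!scompA phia; apply: smapP.
have [||g [g1 g2]] := @gap_cod_pair _ (scomp (sc_incl M) phi) psi.
- by rewrite psib.
- by move=> m c; apply: (proj2_sig (phi m c)).
exists g; last exact: to_pt_eq.
apply: gap_cod_ext; last by rewrite scompA g2.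
by rewrite scompA g1 -scompA phia; apply: smapP.
Qed.

Lemma gap_trivial_of_weq : smono u -> reedy_fibrant Y -> kan_complex (sc_sset M) ->
  weak_equivalence gap_over -> gap_trivial.
Proof.
move=> mu rY kM w; apply/gap_trivialP; apply: boundary_rlp_of_weq => //.
  exact: gap_over_kan.
exact: gap_cod_kan.
Qed.

End Gap.

Lemma gap_trivial_sub (A A' : sSet) (u : smap A A') (M M' : subcpx (bslash A X)) :
    (forall n (x : bslash A X n), scmem M x -> scmem M' x) ->
  gap_trivial u M' -> gap_trivial u M.
Proof. by move=> MM L n a phi psi h1 h2 h3 h4; apply: L => // k c; apply: MM. Qed.

(** One lifts first to A'\X and then to A''\X. The first lift restricts into [M], hence lies in the
    preimage over which the second gap map is taken. *)
Lemma gap_trivial_comp (A A' A'' : sSet) (u : smap A A') (v : smap A' A'')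
    (M : subcpx (bslash A X)) :
  gap_trivial u M -> gap_trivial v (sc_preim (bslash_res u X) M) ->
  gap_trivial (scomp v u) M.
Proof.
move=> Lu Lv n a phi psi aphi apsi H hM.
rewrite bslash_res_comp -scompA in aphi; rewrite bslash_res_comp -scompA in H.
have [||//|//|l1 [l1i l1phi l1psi]] := Lu n (scomp (bslash_res v X) a) phi (scomp (bslash_res v Y) psi).
- exact: aphi.
- by rewrite scompA bslash_sq -!scompA apsi.
have [|//||k c|l [li ll1 lpsi]] := Lv n a l1 psi.
- by rewrite l1i.
- exact: l1psi.
- by have /= := smap_eqP l1phi c => h; rewrite /= h; apply: hM.
by exists l; split=> //; rewrite bslash_res_comp -scompA ll1.
Qed.

(* Two-out-of-three for the composite
   A''\X -> A'\X x_{A'\Y} A''\Y -> A\X x_{A\Y} A''\Y. *)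
Lemma gap_trivial_cancel (A A' A'' : sSet) (u : smap A A') (v : smap A' A'')
    (M : subcpx (bslash A X)) :
    reedy_fibration f -> reedy_fibrant Y -> smono v ->
    kan_complex (sc_sset (sc_preim (bslash_res u X) M)) ->
  gap_trivial u M -> gap_trivial (scomp v u) M ->
  gap_trivial v (sc_preim (bslash_res u X) M).
Proof.
move=> rf rY mv kM Lu Lvu; apply: gap_trivial_of_weq => //.
set M' := sc_preim _ M.
have [||r [r1 r2]] := @gap_cod_pair _ _ (scomp v u) M (sc_sset (gap_cod v M'))
    (scomp (bslash_res u X) (gap_fst v M')) (gap_snd v M').
- rewrite bslash_res_comp scompA bslash_sq -!scompA; congr scomp.
  have := @gap_cod_sq _ _ v M' _ (sidm _); rewrite !scompId.
  exact.
- by move=> n c; apply: (proj2_sig c).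
have rfst k (x : sc_sset (gap_cod v M') k) :
    gap_fst (scomp v u) M k (r k x) = bslash_res u X k (gap_fst v M' k x).
  exact: (smap_eqP r1).
have rsnd k (x : sc_sset (gap_cod v M') k) : gap_snd (scomp v u) M k (r k x) = gap_snd v M' k x.
  exact: (smap_eqP r2).
(* The map [r] is a base change of the gap map of [u], and its composite with the gap map of [v] is
   the gap map of [scomp v u]; both lift against boundaries by hypothesis. *)
apply: (weq_cancel (g := r)); apply: boundary_rlp_weq => n a b ab.
- have [||||l [li lphi lpsi]] := Lu n (scomp (gap_fst v M') a)
    (scomp (gap_fst (scomp v u) M) b) (scomp (bslash_res v Y) (scomp (gap_snd (scomp v u) M) b)).
  + apply: smapP => k c; have e := smap_eqP ab c.
    exact: etrans (esym (rfst k (a k c))) (congr1 (gap_fst (scomp v u) M k) e).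
  + apply: smapP => k c; have e := smap_eqP ab c.
    have e2 := etrans (esym (rsnd k (a k c))) (congr1 (gap_snd (scomp v u) M k) e).
    have e3 := smap_eqP (gap_cod_sq a) c.
    exact: etrans e3 (congr1 (bslash_res v Y k) e2).
  + rewrite gap_cod_sq; apply: smapP => k c.
    exact: (smap_eqP (bslash_res_comp u v Y)).
  + by move=> k c; apply: (proj2_sig (b k c)).
  have [||g [g1 g2]] := @gap_cod_pair _ _ v M' _ l (scomp (gap_snd (scomp v u) M) b).
  + exact: lpsi.
  + by move=> k c; have /= := smap_eqP lphi c => h; rewrite /= h; apply: (proj2_sig (b k c)).
  exists g.
    apply: gap_cod_ext; first by rewrite scompA g1.
    rewrite scompA g2; apply: smapP => k c; have e := smap_eqP ab c.
    exact: etrans (esym (congr1 (gap_snd (scomp v u) M k) e)) (rsnd k (a k c)).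
  apply: gap_cod_ext; first by rewrite scompA r1 -lphi -g1; apply: smapP.
  by rewrite scompA r2 g2.
- pose a' := scomp (sc_incl _) a.
  have [||||l [li lphi lpsi]] := Lvu n a' (scomp (gap_fst (scomp v u) M) b)
      (scomp (gap_snd (scomp v u) M) b).
  + rewrite bslash_res_comp; apply: smapP => k c; have e := smap_eqP ab c.
    exact: etrans (esym (rfst k _)) (congr1 (gap_fst (scomp v u) M k) e).
  + apply: smapP => k c; have e := smap_eqP ab c.
    exact: etrans (esym (rsnd k _)) (congr1 (gap_snd (scomp v u) M k) e).
  + exact: gap_cod_sq.
  + by move=> k c; apply: (proj2_sig (b k c)).
  have lP k c : scmem (sc_preim (bslash_gap v f) (gap_cod v M')) (l k c).
    have e := smap_eqP lphi c; rewrite bslash_res_comp /= in e.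
    by rewrite /= e; apply: (proj2_sig (b k c)).
  exists (sc_lift lP); first by apply: sc_sset_ext; pointwise li.
  apply: gap_cod_ext.
    rewrite -lphi; apply: smapP => k c.
    have e1 := rfst k (gap_over v M' k (sc_lift lP k c)).
    transitivity (bslash_res u X k (bslash_res v X k (l k c))); first exact: e1.
    exact: esym (smap_eqP (bslash_res_comp u v X) (l k c)).
  by rewrite -lpsi; apply: smapP => k c; apply: rsnd.
Qed.

End GapMaps.

(** * Gap maps and pushouts *)

Lemma bmap_unique_choice (X Y : bsSet) (R : forall m n, X m n -> Y m n -> Prop) :
    (forall m n x, exists y, R m n x y) ->
    (forall m n x y y', R m n x y -> R m n x y' -> y = y') ->
    (forall m m' n n' (a : dhom m m') (b : dhom n n') x y,
       R m' n' x y -> R m n (bact a b x) (bact a b y)) ->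
  exists f : bmap X Y, forall m n x, R m n x (f m n x).
Proof.
move=> tot fn nat.
pose F m n x := proj1_sig (cid (tot m n x)).
have FR m n x : R m n x (F m n x) by apply: (proj2_sig (cid (tot m n x))).
have FN m m' n n' (a : dhom m m') (b : dhom n n') x :
    F m n (bact a b x) = bact a b (F m' n' x).
  by apply: (fn m n (bact a b x)) => //; apply: nat.
by exists (BMap FN).
Qed.

(** Levelwise form of a gluing: [B'] is the union of the images of the injective maps [phi] and [v],
    and [A] covers their intersection. *)
Record pushout_square (A A' B B' : sSet) (u : smap A A') (v : smap B B')
    (phi0 : smap A B) (phi : smap A' B') : Prop := PushoutSquare {
  po_comm : scomp v phi0 = scomp phi u;
  po_injv : forall n, injective (v n);
  po_inj : forall n, injective (phi n);
  po_surj : forall n b', (exists a', phi n a' = b') \/ (exists b, v n b = b');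
  po_pull : forall n a' b, phi n a' = v n b -> exists a, u n a = a' /\ phi0 n a = b }.

Section Pushout.
Variables (A A' B B' : sSet) (u : smap A A') (v : smap B B').
Variables (phi0 : smap A B) (phi : smap A' B').
Hypothesis po : pushout_square u v phi0 phi.

(** With [bslash_glue_unique], this says that mapping into [X] turns the pushout into a pullback of
    mapping complexes. *)
Lemma bslash_glue (X : bsSet) n (x : bslash A' X n) (y : bslash B X n) :
    bslash_res u X n x = bslash_res phi0 X n y ->
  exists z : bslash B' X n, bslash_res phi X n z = x /\ bslash_res v X n z = y.
Proof.
move=> xy.
have xyE k l (a : A k) (c : simplex n l) : x k l (u k a, c) = y k l (phi0 k a, c).
  exact: (congr1 (fun F : bslash A X n => F k l (a, c)) xy).
have [|||z zP] := @bmap_unique_choice (box B' (simplex n)) X (fun k l bc w =>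
    (exists a', phi k a' = bc.1 /\ w = x k l (a', bc.2)) \/
    (exists b, v k b = bc.1 /\ w = y k l (b, bc.2))).
- move=> k l [b' c]; case: (po_surj po b') => -[d <-].
    by exists (x k l (d, c)); left; exists d.
  by exists (y k l (d, c)); right; exists d.
- have aux k l (a' : A' k) (b : B k) (c : simplex n l) : phi k a' = v k b -> x k l (a', c) = y k l (b, c).
    by move=> /(po_pull po)[a [<- <-]].
  move=> k l [b' c] w w' [] [d [/= <- ->]] [] [d' [/= e ->]].
  + by rewrite (po_inj po e).
  + by apply: aux.
  + by symmetry; apply: aux.
  + by rewrite (po_injv po e).
- move=> k k' l l' a b [b' c] w [] [d [/= <- ->]]; [left|right]; exists (sact a d);
    by rewrite smap_nat -bmap_nat.
exists z; split; apply: bmapP => k l [d c] /=.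
  case: (zP k l (phi k d, c)) => -[d' [/= e ->]]; first by rewrite (po_inj po e).
  by have [a [<- <-]] := po_pull po (esym e); rewrite xyE.
case: (zP k l (v k d, c)) => -[d' [/= e ->]]; last by rewrite (po_injv po e).
by have [a [<- <-]] := po_pull po e; rewrite xyE.
Qed.

Lemma bslash_glue_unique (X : bsSet) n (z z' : bslash B' X n) :
  bslash_res phi X n z = bslash_res phi X n z' ->
  bslash_res v X n z = bslash_res v X n z' -> z = z'.
Proof.
move=> e1 e2; apply: bmapP => k l [b' c]; case: (po_surj po b') => -[d <-].
  exact: (congr1 (fun F : bslash A' X n => F k l (d, c)) e1).
exact: (congr1 (fun F : bslash B X n => F k l (d, c)) e2).
Qed.

Lemma bslash_po_comm (X : bsSet) n (z : bslash B' X n) :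
  bslash_res phi0 X n (bslash_res v X n z) = bslash_res u X n (bslash_res phi X n z).
Proof.
have := bslash_res_comp phi0 v X; rewrite (po_comm po) bslash_res_comp => h.
exact: esym (smap_eqP h z).
Qed.

(** The gap map of [v] is a base change of that of [u]: a lift found on A' is glued to the map
    already given on [B]. *)
Lemma gap_trivial_pushout (X Y : bsSet) (f : bmap X Y) (M : subcpx (bslash A X))
    (N : subcpx (bslash B X)) :
    (forall n (y : bslash B X n), scmem N y -> scmem M (bslash_res phi0 X n y)) ->
  gap_trivial f u M -> gap_trivial f v N.
Proof.
move=> NM L n a g psi ag apsi H gN.
have [||||l' [l'i l'g l'psi]] := L n (scomp (bslash_res phi X) a)
    (scomp (bslash_res phi0 X) g) (scomp (bslash_res phi Y) psi).
- apply: smapP => k c; apply: etrans (esym (bslash_po_comm _)) _.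
  exact: (congr1 (bslash_res phi0 X k) (smap_eqP ag c)).
- apply: smapP => k c; have e := smap_eqP apsi c.
  have e2 := smap_eqP (bslash_sq phi f) (a k c).
  exact: etrans e2 (congr1 (bslash_res phi Y k) e).
- apply: smapP => k c; have e := congr1 (bslash_res phi0 Y k) (smap_eqP H c).
  have e2 := smap_eqP (bslash_sq phi0 f) (g k c).
  exact: etrans e2 (etrans e (bslash_po_comm _)).
- by move=> k c; apply: NM.
have [|||l lP] := @smap_unique_choice (simplex n) (bslash B' X) (fun k c z =>
    bslash_res phi X k z = l' k c /\ bslash_res v X k z = g k c).
- by move=> k c; apply: bslash_glue; apply: (smap_eqP l'g).
- by move=> k c z z' [e1 e2] [e1' e2']; apply: bslash_glue_unique; rewrite ?e1 ?e2.
- by move=> m k d c z [e1 e2]; rewrite !smap_nat e1 e2.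
exists l; split.
- apply: smapP => k c; apply: bslash_glue_unique.
    exact: etrans (lP k _).1 (smap_eqP l'i c).
  exact: etrans (lP k _).2 (esym (smap_eqP ag c)).
- by apply: smapP => k c; apply: (lP k c).2.
- apply: smapP => k c; apply: bslash_glue_unique.
    have e2 := smap_eqP (bslash_sq phi f) (l k c).
    have e3 := congr1 (bslash_push A' f k) (lP k c).1.
    exact: etrans (esym e2) (etrans e3 (smap_eqP l'psi c)).
  have e2 := smap_eqP (bslash_sq v f) (l k c).
  have e3 := congr1 (bslash_push B f k) (lP k c).2.
  exact: etrans (esym e2) (etrans e3 (smap_eqP H c)).
Qed.

End Pushout.

(** * Segal spaces and spine inclusions *)

Definition sc_full (A : sSet) : subcpx A := @SubCpx A (fun _ _ => True) (fun _ _ _ _ h => h).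

Lemma kan_full (A : sSet) : kan_complex A -> kan_complex (sc_sset (sc_full A)).
Proof.
move=> kA n k n0 a b _.
have [|l la _] := kA n k n0 (scomp (sc_incl _) a) b; first exact: to_pt_eq.
exists (@sc_lift _ _ (sc_full A) l (fun _ _ => I)); last exact: to_pt_eq.
by apply: sc_sset_ext; pointwise la.
Qed.

(** The restriction map of [X] is the gap map followed by the projection to A\X, and that projection
    is a base change of the restriction map of [Y]. Two-out-of-three makes the gap map a weak
    equivalence. *)
Lemma gap_trivial_of_res (X Y : bsSet) (f : bmap X Y) (A A' : sSet) (u : smap A A') :
    reedy_fibration f -> reedy_fibrant X -> reedy_fibrant Y -> smono u ->
    boundary_rlp (bslash_res u X) -> boundary_rlp (bslash_res u Y) ->
  gap_trivial f u (sc_full _).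
Proof.
move=> rf rX rY mu bX bY; apply: gap_trivial_of_weq => //.
  by apply: kan_full; apply: bslash_kan.
apply: (weq_cancel (g := gap_fst f u (sc_full _))); apply: boundary_rlp_weq => n a b ab.
- have [|psi psia psib] := bY n (scomp (gap_snd f u (sc_full _)) a) (scomp (bslash_push A f) b).
    by rewrite -gap_cod_sq ab scompA.
  have [||g [g1 g2]] := @gap_cod_pair _ _ f _ _ u (sc_full _) _ b psi => //.
  exists g => //; apply: gap_cod_ext; first by rewrite scompA g1 ab.
  by rewrite scompA g2.
- have [|l la lb] := bX n (scomp (sc_incl _) a) b; first by rewrite -ab; apply: smapP.
  exists (@sc_lift _ _ (sc_preim (bslash_gap u f) (gap_cod f u (sc_full _))) l (fun _ _ => I)).
    by apply: sc_sset_ext; pointwise la.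
  by pointwise lb.
Qed.

Lemma sc_incl_mono (A : sSet) (S : subcpx A) : smono (sc_incl S).
Proof.
by apply: inj_smono => n [x hx] [y hy] /= e; apply: eq_exist.
Qed.

Lemma segal_boundary_rlp (X : bsSet) n : segal_space X -> 2 <= n ->
  boundary_rlp (bslash_res (sc_incl (spine n)) X).
Proof.
move=> [rX sX] n2; apply: boundary_rlp_of_weq; last exact: sX.
  by apply: bslash_res_kan => //; apply: sc_incl_mono.
exact: bslash_kan.
Qed.

Lemma segal_gap_trivial (X Y : bsSet) (f : bmap X Y) n :
    segal_space X -> segal_space Y -> reedy_fibration f -> 2 <= n ->
  gap_trivial f (sc_incl (spine n)) (sc_full _).
Proof.
move=> sX sY rf n2; apply: gap_trivial_of_res => //.
- exact: sX.1.
- exact: sY.1.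
- exact: sc_incl_mono.
- exact: segal_boundary_rlp.
- exact: segal_boundary_rlp.
Qed.

(** * Strict fibers over an edge *)

(** The strict fiber as a subcomplex of A\X, without the point component carried by [bfib];
    [bfib_gap_compare] identifies the two forms. *)
Definition edge_fib (A : sSet) (a : A 1) (X : bsSet) (e : X 1 0) : subcpx (bslash A X) :=
  sc_preim (bslash_res (yoneda a) X) (sc_vertex (edge_vertex e)).

Lemma kan_edge_fib (A : sSet) (a : A 1) (X : bsSet) (e : X 1 0) :
  reedy_fibrant X -> smono (yoneda a) -> kan_complex (sc_sset (edge_fib a e)).
Proof. by move=> rX ma; apply: kan_fiber; apply: bslash_res_kan. Qed.

Lemma edge_fib_res (X : bsSet) (e : X 1 0) (A A' : sSet) (u : smap A A') (a : A 1) n (x : bslash A' X n) :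
  scmem (edge_fib a e) (bslash_res u X n x) <-> scmem (edge_fib (u 1 a) e) x.
Proof.
rewrite /=; have -> // : bcomp (bcomp x (box_map u (sidm (simplex n))))
    (box_map (yoneda a) (sidm (simplex n))) =
  bcomp x (box_map (yoneda (u 1 a)) (sidm (simplex n))).
by apply: bmapP => k l [y c] /=; rewrite smap_nat.
Qed.

Lemma gap_cod_inj (X Y : bsSet) (f : bmap X Y) (A A' : sSet) (u : smap A A')
    (M : subcpx (bslash A X)) n (c c' : sc_sset (gap_cod f u M) n) :
  gap_fst f u M n c = gap_fst f u M n c' -> gap_snd f u M n c = gap_snd f u M n c' -> c = c'.
Proof.
case: c c' => [[[x y] h] hM] [[[x' y'] h'] hM'] /= ex ey; subst x' y'.
by apply: eq_exist; apply: eq_exist.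
Qed.

Section EdgeFiber.
Variables (X Y : bsSet) (f : bmap X Y) (e : X 1 0).

Lemma edge_fib_push (A : sSet) (a : A 1) n (x : bslash A X n) :
  scmem (edge_fib a e) x -> scmem (edge_fib a (f 1 0 e)) (bslash_push A f n x).
Proof.
move=> h; apply: bmapP => k l c.
have /= -> := congr1 (fun F : bmap _ X => f k l (F k l c)) h.
by rewrite bmap_nat.
Qed.

Section Comparison.
Variables (A A' : sSet) (u : smap A A') (a : A 1).
Let E := sc_sset (sc_preim (bslash_gap u f) (gap_cod f u (edge_fib a e))).
Let B := sc_sset (gap_cod f u (edge_fib a e)).

(** The components in the point carry no information, so the sources and targets of the two gap maps
    are isomorphic, compatibly with these maps. *)
Lemma bfib_gap_compare :
  exists (jE : smap (bfib (u 1 a) e) E)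
         (jB : smap (spull (bfib_push a f e) (bfib_res u a (f 1 0 e))) B)
         kE kB,
    [/\ scomp kE jE = sidm _, scomp jE kE = sidm _,
        scomp kB jB = sidm _, scomp jB kB = sidm _ &
        scomp jB (bfib_gap u a f e) = scomp (gap_over f u (edge_fib a e)) jE].
Proof.
have jEP n (c : bfib (u 1 a) e n) :
    scmem (sc_preim (bslash_gap u f) (gap_cod f u (edge_fib a e))) (spull_fst _ _ n c).
  by apply/(edge_fib_res e u a); case: c => -[x t] h.
pose jE : smap (bfib (u 1 a) e) E := sc_lift jEP.
pose pX := scomp (spull_fst (bslash_res (yoneda a) X) (pt_incl (edge_vertex e)))
  (spull_fst (bfib_push a f e) (bfib_res u a (f 1 0 e))).
pose pY := scomp (spull_fst (bslash_res (yoneda (u 1 a)) Y) (pt_incl (edge_vertex (f 1 0 e))))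
  (spull_snd (bfib_push a f e) (bfib_res u a (f 1 0 e))).
have [||jB [jB1 jB2]] := @gap_cod_pair _ _ f _ _ u (edge_fib a e) _ pX pY.
- apply: smapP => n [[[[x t] h] [[y t'] h']] hh].
  by have /= := congr1 (fun p => (proj1_sig p).1) hh.
- by move=> n [[[[x t] h] [[y t'] h']] hh].
have [kE kEj jEk] : exists2 kE, scomp kE jE = sidm _ & scomp jE kE = sidm _.
  apply: smap_bij_iso => n.
    move=> [[x []] hx] [[y []] hy] /(congr1 (@proj1_sig _ _)) /= exy.
    by apply: eq_exist; rewrite exy.
  move=> [x hx]; have hx' := (edge_fib_res e u a x).1 hx.
  by exists (exist _ (x, tt) hx'); apply: eq_exist.
have [kB kBj jBk] : exists2 kB, scomp kB jB = sidm _ & scomp jB kB = sidm _.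
  apply: smap_bij_iso => n.
    move=> c c' ecc'.
    have e1 := etrans (esym (smap_eqP jB1 c)) (etrans (congr1 (gap_fst f u _ n) ecc') (smap_eqP jB1 c')).
    have e2 := etrans (esym (smap_eqP jB2 c)) (etrans (congr1 (gap_snd f u _ n) ecc') (smap_eqP jB2 c')).
    move: e1 e2; clear; case: c c' => [[[[x []] h] [[y []] h']] hh] [[[[x' []] k] [[y' []] k']] kk] /= e1 e2.
    by subst x' y'; apply: eq_exist; congr pair; apply: eq_exist.
  move=> c.
  have hx : scmem (edge_fib a e) (gap_fst f u _ n c) by apply: (proj2_sig c).
  have sq : bslash_push A f n (gap_fst f u _ n c) = bslash_res u Y n (gap_snd f u _ n c).
    exact: (proj2_sig (proj1_sig c)).
  (* That the component in [Y] lies over [f(e)] follows from the one in [X] lying over [e], since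
     both have the same image in A\Y. *)
  have hy : scmem (edge_fib (u 1 a) (f 1 0 e)) (gap_snd f u _ n c).
    by apply/(edge_fib_res (f 1 0 e) u a); rewrite -sq; apply: edge_fib_push.
  pose x' : bfib a e n := exist _ (gap_fst f u _ n c, tt) hx.
  pose y' : bfib (u 1 a) (f 1 0 e) n := exist _ (gap_snd f u _ n c, tt) hy.
  have xy : bfib_push a f e n x' = bfib_res u a (f 1 0 e) n y'.
    by apply: eq_exist; congr pair.
  exists (exist _ (x', y') xy); apply: gap_cod_inj.
    exact: (smap_eqP jB1).
  exact: (smap_eqP jB2).
exists jE, jB, kE, kB; split=> //.
apply: gap_cod_ext.
  by apply: smapP => n c; apply: etrans (smap_eqP jB1 _) _.
by apply: smapP => n c; apply: etrans (smap_eqP jB2 _) _.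
Qed.

End Comparison.
End EdgeFiber.

Section Transfer.
Variables (X Y : bsSet) (f : bmap X Y) (e : X 1 0).
Hypotheses (reedy_f : reedy_fibration f) (reedy_X : reedy_fibrant X) (reedy_Y : reedy_fibrant Y).
Variables (A A' : sSet) (u : smap A A') (a : A 1).

Lemma gap_trivial_of_bfib : smono u -> smono (yoneda a) ->
  weak_equivalence (bfib_gap u a f e) -> gap_trivial f u (edge_fib a e).
Proof.
move=> mu ma w; have [jE [jB [kE [kB [kEj jEk kBj jBk sq]]]]] := bfib_gap_compare f e u a.
apply: gap_trivial_of_weq => //; first exact: kan_edge_fib.
have -> : gap_over f u (edge_fib a e) = scomp (scomp jB (bfib_gap u a f e)) kE.
  by rewrite sq -scompA jEk scompId.
apply: weq_comp; first exact: weq_iso kEj.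
by apply: weq_comp => //; apply: weq_iso jBk.
Qed.

Lemma bfib_trivial_fibration : smono u ->
  gap_trivial f u (edge_fib a e) -> trivial_fibration (bfib_gap u a f e).
Proof.
move=> mu L; have [jE [jB [kE [kB [kEj jEk kBj jBk sq]]]]] := bfib_gap_compare f e u a.
split.
- move=> n k n0 c b cb.
  have [|l lc lb] := gap_over_kan (M := edge_fib a e) reedy_f mu n0 (k := k)
    (a := scomp jE c) (b := scomp jB b).
    by rewrite scompA -sq -!scompA cb.
  exists (scomp kE l); first by rewrite -scompA lc scompA kEj scompdI.
  rewrite -[LHS]scompdI -kBj -scompA [scomp jB _]scompA sq.
  by rewrite -[scomp (scomp _ jE) _]scompA [scomp jE _]scompA jEk scompdI lb scompA kBj scompdI.
- have -> : bfib_gap u a f e = scomp (scomp kB (gap_over f u (edge_fib a e))) jE.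
    by rewrite -scompA -sq scompA kBj scompdI.
  apply: weq_comp; first exact: weq_iso jEk.
  apply: weq_comp; last exact: weq_iso kBj.
  by apply: boundary_rlp_weq; apply/gap_trivialP.
Qed.

End Transfer.

(** This map is a base change of the gap map of the edge inclusion [yoneda a]: a lift is sought
    whose restriction to the edge is constant at [e]. *)
Lemma bfib_push_kan (X Y : bsSet) (f : bmap X Y) (e : X 1 0) (A : sSet) (a : A 1) :
  reedy_fibration f -> smono (yoneda a) -> kan_fibration (bfib_push a f e).
Proof.
move=> rf ma n k n0 c b cb.
pose v := scomp (pt_incl (edge_vertex e)) (to_pt (simplex n)).
have [||||l [lc lv lb]] := @rlp_gap_lifts _ _ f _ _ (yoneda a) (sc_full _) _ _ _ (rf _ _ _ ma n k n0)
    (scomp (spull_fst _ _) c) v (scomp (spull_fst _ _) b).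
- apply: smapP => m x; exact: (proj2_sig (c m x)).
- by have h := congr1 (scomp (spull_fst _ _)) cb; pointwise h.
- apply: smapP => m x; apply: etrans (esym (proj2_sig (b m x))).
  by apply: bmapP => p q [y z] /=; rewrite bmap_nat.
- by [].
exists (spull_pair (lv : scomp (bslash_res (yoneda a) X) l =
    scomp (pt_incl (edge_vertex e)) (to_pt (simplex n)))).
  by apply: spull_ext; [pointwise lc|apply: to_pt_eq].
by apply: spull_ext; [pointwise lb|apply: to_pt_eq].
Qed.

Lemma yoneda_edge01_inj n (n1 : 0 < n) : forall m, injective (@yoneda (simplex n) 1 (edge01 n) m).
Proof.
move=> m c c' h; apply: dhomP => t; apply: val_inj.
have {}h : dcomp (edge01 n) c = dcomp (edge01 n) c' := h.
have := congr1 (fun d : dhom m n => d t : nat) h.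
rewrite !dcompE !mkdhomE !inordK ?ltnS ?geq_minr //.
by move: (ltn_ord (c t)) (ltn_ord (c' t)) => /=; lia.
Qed.

(** The right-hand vertical map of the square is already a Kan fibration, so the homotopy pullback
    condition applied to its factorization through the identity says that the gap map itself is a
    weak equivalence. *)
Lemma cocartesian_gap_trivial (X Y : bsSet) (f : bmap X Y) (e : X 1 0) :
    reedy_fibration f -> reedy_fibrant X -> reedy_fibrant Y -> cocartesian f e ->
  gap_trivial f (horn0_incl 2) (edge_fib (horn_edge (leqnn 2)) e).
Proof.
move=> rf rX rY coc.
have ma : smono (yoneda (horn_edge (leqnn 2))).
  apply: inj_smono => m c c' /(congr1 (@proj1_sig _ _)); exact: yoneda_edge01_inj.
apply: gap_trivial_of_bfib => //; first exact: sc_incl_mono.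
have idweq (Z : sSet) : weak_equivalence (sidm Z) by apply: (@weq_iso _ _ _ (sidm Z)); apply: smapP.
have := coc _ (sidm _) (bfib_push (horn_edge (leqnn 2)) f e) (scompId _) (idweq _)
  (bfib_push_kan rf ma).
by congr weak_equivalence; apply: spull_ext; apply: smapP.
Qed.

(** * Subcomplexes of a simplex *)

Lemma dhom_lt_inj k N (iota : dhom k N) : (forall i j : 'I_k.+1, i < j -> iota i < iota j) ->
  forall m (c c' : dhom m k), dcomp iota c = dcomp iota c' -> c = c'.
Proof.
move=> mono m c c' h; apply: dhomP => t; apply: val_inj => /=.
have := congr1 (fun d : dhom m N => d t : nat) h; rewrite !dcompE.
by case: (ltngtP (c t) (c' t)) => // /mono; lia.
Qed.

Lemma dhom_factor k N (iota : dhom k N) m (y : dhom m N) :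
  (forall i j : 'I_k.+1, i < j -> iota i < iota j) ->
  (forall t, exists i, iota i = y t) -> exists c, y = dcomp iota c.
Proof.
move=> mono im.
pose c t := proj1_sig (cid (im t)).
have cE t : iota (c t) = y t by apply: (proj2_sig (cid (im t))).
have cP (t t' : 'I_m.+1) : t <= t' -> c t <= c t'.
  move=> /(dhom_homo y); rewrite -!cE; apply: contraTT; rewrite -!ltnNge.
  exact: mono.
by exists (mkdhom cP); apply: dhomP => t; rewrite dcompE mkdhomE cE.
Qed.

(** The increasing enumeration of [U], which presents [face U] as a simplex of dimension
    [#|U|.-1]. *)
Lemma dhom_enum N (U : {set 'I_N.+1}) : 0 < #|U| ->
  exists iota : dhom #|U|.-1 N,
    (forall i j : 'I_(#|U|.-1.+1), i < j -> iota i < iota j) /\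
    (forall x, x \in U <-> exists i, iota i = x).
Proof.
move=> U0; pose s := [seq x <- enum 'I_N.+1 | x \in U].
have memU x : (x \in s) = (x \in U) by rewrite mem_filter mem_enum andbT.
have us : uniq s by apply: filter_uniq; apply: enum_uniq.
have sz : size s = #|U|.
  by rewrite -(card_uniqP us); apply: eq_card => x; rewrite memU.
have srt : sorted (fun x y : 'I_N.+1 => x < y) s.
  apply: sorted_filter; first by move=> x y z; apply: ltn_trans.
  have : sorted ltn (map val (enum 'I_N.+1)) by rewrite val_enum_ord iota_ltn_sorted.
  by rewrite sorted_map.
have lt (i j : 'I_(#|U|.-1.+1)) : i < j -> nth ord0 s i < nth ord0 s j.
  move=> ij; apply: (sorted_ltn_nth _ _ srt) => //.
  - by move=> x y z; apply: ltn_trans.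
  - by rewrite inE sz; have := ltn_ord i; lia.
  - by rewrite inE sz; have := ltn_ord j; lia.
have le (i j : 'I_(#|U|.-1.+1)) : i <= j -> nth ord0 s i <= nth ord0 s j.
  by rewrite leq_eqVlt => /orP[/eqP/val_inj ->//|/lt/ltnW].
exists (mkdhom le); split=> [i j ij|x]; first by rewrite !mkdhomE lt.
rewrite -memU; split=> [xs|[i <-]].
  have h : index x s < #|U|.-1.+1 by rewrite prednK // -sz index_mem.
  by exists (Ordinal h); rewrite mkdhomE /= nth_index.
by rewrite mkdhomE mem_nth // sz; have := ltn_ord i; lia.
Qed.

Definition sc_sub (A : sSet) (K L : subcpx A) : Prop :=
  forall n (x : A n), scmem K x -> scmem L x.

Program Definition sc_inclusion (A : sSet) (K L : subcpx A) (h : sc_sub K L) :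
    smap (sc_sset K) (sc_sset L) :=
  @SMap (sc_sset K) (sc_sset L) (fun n x => exist _ (proj1_sig x) (h n _ (proj2_sig x))) _.
Next Obligation. exact: eq_exist. Qed.

Lemma sc_inclusion_inj (A : sSet) (K L : subcpx A) (h : sc_sub K L) n :
  injective (sc_inclusion h n).
Proof. by move=> [x hx] [y hy] /(congr1 (@proj1_sig _ _)) /= e; apply: eq_exist. Qed.

Program Definition sc_union (A : sSet) (K L : subcpx A) : subcpx A :=
  @SubCpx A (fun n x => scmem K x \/ scmem L x) _.
Next Obligation. by case: H => h; [left|right]; apply: sc_act. Qed.

(** The spine of [face U], without enumerating [U]: a simplex lies on an edge between consecutive
    elements of [U] exactly when no element of [U] is strictly between two of its vertices. *)
Program Definition spine_on N (U : {set 'I_N.+1}) : subcpx (simplex N) :=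
  @SubCpx (simplex N) (fun m (x : dhom m N) => (forall t, x t \in U) /\
    forall t t' c, c \in U -> ~ (x t < c /\ c < x t')) _.
Next Obligation.
case: H => h1 h2; split=> [t|t t' c cU]; rewrite !dcompE; first exact: h1.
exact: h2.
Qed.

Lemma edge01_val n t : 0 < n -> edge01 n t = t :> nat.
Proof. by move=> n0; rewrite mkdhomE inordK; have := ltn_ord t; lia. Qed.

(** * Good inclusions of subcomplexes of a simplex *)

Section Good.
Variables (X Y : bsSet) (f : bmap X Y) (e : X 1 0) (N : nat).
Hypothesis N2 : 2 <= N.
Hypotheses (segal_X : segal_space X) (segal_Y : segal_space Y).
Hypotheses (reedy_f : reedy_fibration f) (coc : cocartesian f e).

Let E01 : simplex N 1 := edge01 N.

Lemma smono_edge01 (K : subcpx (simplex N)) (h : scmem K E01) :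
  smono (@yoneda (sc_sset K) 1 (exist _ E01 h)).
Proof.
apply: inj_smono => m c c' /(congr1 (@proj1_sig _ _)).
by apply: yoneda_edge01_inj; lia.
Qed.

(* Vacuous when [K] does not contain the edge 01, so that inclusions with and
   without that edge are treated alike. *)
Program Definition edge_fib_on (K : subcpx (simplex N)) : subcpx (bslash (sc_sset K) X) :=
  @SubCpx (bslash (sc_sset K) X)
    (fun n x => forall h : scmem K E01, @scmem _ (edge_fib (exist _ E01 h : sc_sset K 1) e) n x) _.
Next Obligation.
move=> h; exact: (@sc_act _ (edge_fib (exist _ E01 h : sc_sset K 1) e) _ _ a x (H h)).
Qed.

Lemma edge_fib_onE (K : subcpx (simplex N)) (h : scmem K E01) :
  edge_fib_on K = edge_fib (exist _ E01 h : sc_sset K 1) e.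
Proof.
apply: subcpxP => n x; split; first exact.
by move=> H h'; rewrite (Prop_irrelevance h' h).
Qed.

Lemma edge_fib_on_res (K L : subcpx (simplex N)) (KL : sc_sub K L) n
    (x : bslash (sc_sset L) X n) :
  scmem (edge_fib_on L) x -> scmem (edge_fib_on K) (bslash_res (sc_inclusion KL) X n x).
Proof. by move=> H h; apply/edge_fib_res; apply: (H (KL _ _ h)). Qed.

Lemma edge_fib_on_preim (K L : subcpx (simplex N)) (KL : sc_sub K L) (h : scmem K E01) :
  sc_preim (bslash_res (sc_inclusion KL) X) (edge_fib_on K) = edge_fib_on L.
Proof.
apply: subcpxP => n x; split; last exact: edge_fib_on_res.
move=> /(_ h)/edge_fib_res H; rewrite (edge_fib_onE (KL _ _ h)).
exact: H.
Qed.

Lemma kan_edge_fib_on_preim (K L : subcpx (simplex N)) (KL : sc_sub K L) :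
  kan_complex (sc_sset (sc_preim (bslash_res (sc_inclusion KL) X) (edge_fib_on K))).
Proof.
have [h|h] := pselect (scmem K E01).
  rewrite (edge_fib_on_preim KL h) (edge_fib_onE (KL _ _ h)).
  by apply: kan_edge_fib; [exact: segal_X.1|exact: smono_edge01].
have -> : sc_preim (bslash_res (sc_inclusion KL) X) (edge_fib_on K) = sc_full _.
  by apply: subcpxP => n x; split=> // _ h'; case: h.
by apply: kan_full; apply: bslash_kan; apply: segal_X.1.
Qed.

(** The inclusion proof is quantified, so that [good K L] speaks of the two subcomplexes only; it is
    vacuous unless [K] lies in [L]. *)
Definition good (K L : subcpx (simplex N)) : Prop :=
  forall KL : sc_sub K L, gap_trivial f (sc_inclusion KL) (edge_fib_on K).

Lemma sc_inclusion_comp (K L P : subcpx (simplex N)) (KL : sc_sub K L) (LP : sc_sub L P)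
    (KP : sc_sub K P) : sc_inclusion KP = scomp (sc_inclusion LP) (sc_inclusion KL).
Proof. by apply: smapP => n x; apply: eq_exist. Qed.

(** Since the edge 01 lies in [K], the fiber condition on [L] is inherited from [K], so the
    intermediate lift satisfies it. *)
Lemma good_comp (K L P : subcpx (simplex N)) : scmem K E01 -> sc_sub K L -> sc_sub L P ->
  good K L -> good L P -> good K P.
Proof.
move=> h KL LP gKL gLP KP; rewrite (sc_inclusion_comp KL LP KP).
apply: gap_trivial_comp; first exact: gKL.
by rewrite (edge_fib_on_preim KL h); apply: gLP.
Qed.

(** Cancellation of gap maps gives lifts over the preimage of the fiber condition on [K], and the
    fiber condition on [L] implies that one. *)
Lemma good_cancel (K L P : subcpx (simplex N)) : sc_sub K L ->
  good K L -> good K P -> good L P.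
Proof.
move=> KL gKL gKP LP.
have KP : sc_sub K P by move=> n x /KL/LP.
apply: (gap_trivial_sub (M' := sc_preim (bslash_res (sc_inclusion KL) X) (edge_fib_on K))).
  by move=> n x; apply: edge_fib_on_res.
apply: gap_trivial_cancel => //.
- exact: segal_Y.1.
- by apply: inj_smono => n; apply: sc_inclusion_inj.
- exact: kan_edge_fib_on_preim.
by rewrite -(sc_inclusion_comp KL LP KP); apply: gKP.
Qed.

Lemma good_refl (K L : subcpx (simplex N)) : sc_sub L K -> good K L.
Proof.
move=> LK KL n a phi psi aphi apsi H _.
have uv : scomp (sc_inclusion KL) (sc_inclusion LK) = sidm _.
  by apply: smapP => k x; case: x => x hx; apply: eq_exist.
have vu : scomp (sc_inclusion LK) (sc_inclusion KL) = sidm _.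
  by apply: smapP => k x; case: x => x hx; apply: eq_exist.
have res_id (Z : bsSet) (P : subcpx (simplex N)) : bslash_res (sidm (sc_sset P)) Z = sidm _.
  by apply: smapP => k x; apply: bmapP => p q [y c].
have ruv Z : scomp (bslash_res (sc_inclusion LK) Z) (bslash_res (sc_inclusion KL) Z) = sidm _.
  by rewrite -bslash_res_comp uv res_id.
have rvu Z : scomp (bslash_res (sc_inclusion KL) Z) (bslash_res (sc_inclusion LK) Z) = sidm _.
  by rewrite -bslash_res_comp vu res_id.
exists (scomp (bslash_res (sc_inclusion LK) X) phi); split.
- by rewrite -scompA -aphi scompA ruv scompdI.
- by rewrite scompA rvu scompdI.
- by rewrite scompA bslash_sq -scompA H scompA ruv scompdI.
Qed.

(** The hypotheses make [L] the union of [K] and [L0], with intersection [K0]: a pushout square. *)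
Lemma good_attach (K0 L0 K L : subcpx (simplex N)) :
    sc_sub K0 L0 -> sc_sub K0 K -> sc_sub L0 L ->
    (forall n (x : simplex N n), scmem L x -> scmem K x \/ scmem L0 x) ->
    (forall n (x : simplex N n), scmem K x -> scmem L0 x -> scmem K0 x) ->
  good K0 L0 -> good K L.
Proof.
move=> KL0 K0K L0L cov int g KL.
apply: (@gap_trivial_pushout _ _ _ _ (sc_inclusion KL0) (sc_inclusion KL)
  (sc_inclusion K0K) (sc_inclusion L0L) _ _ _ f (edge_fib_on K0)).
- split.
  + by apply: smapP => n x; apply: eq_exist.
  + exact: sc_inclusion_inj.
  + exact: sc_inclusion_inj.
  + move=> n [x hx]; have [hK|hL] := cov n x hx.
      by right; exists (exist _ x hK); apply: eq_exist.
    by left; exists (exist _ x hL); apply: eq_exist.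
  + move=> n [x hx] [y hy] /(congr1 (@proj1_sig _ _)) /= exy; subst y.
    by exists (exist _ x (int n x hy hx)); split; apply: eq_exist.
- by move=> n y; apply: edge_fib_on_res.
- exact: g.
Qed.

(** Here [L] is [K] with the image of a whole simplex attached along the image of [S]. The fiber
    conditions are compared for every [phi] that acts as [iota], because the actual map is only
    built in the proof. *)
Lemma good_transport k (iota : dhom k N) (S : subcpx (simplex k))
    (M : subcpx (bslash (sc_sset S) X)) (K L : subcpx (simplex N)) :
    (forall i j : 'I_k.+1, i < j -> iota i < iota j) ->
    (forall n (c : dhom n k), scmem L (dcomp iota c : simplex N n)) ->
    (forall n (c : dhom n k), scmem S (c : simplex k n) <-> scmem K (dcomp iota c : simplex N n)) ->
    (forall n (y : dhom n N), scmem L (y : simplex N n) -> ~ scmem K (y : simplex N n) ->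
       forall t, exists i, iota i = y t) ->
    (forall phi : smap (sc_sset S) (sc_sset K),
       (forall n x, proj1_sig (phi n x) = dcomp iota (proj1_sig x)) ->
       forall n (x : bslash (sc_sset K) X n), scmem (edge_fib_on K) x ->
       scmem M (bslash_res phi X n x)) ->
    gap_trivial f (sc_incl S) M ->
  good K L.
Proof.
move=> mono iL SK LK hM g KL.
pose phi0 := @SMap (sc_sset S) (sc_sset K)
  (fun n x => exist _ (dcomp iota (proj1_sig x)) ((SK n _).1 (proj2_sig x)))
  (fun m n a x => eq_exist _ _ (dcompA _ _ _)).
pose phi := @SMap (simplex k) (sc_sset L)
  (fun n x => exist _ (dcomp iota x) (iL n x))
  (fun m n a x => eq_exist _ _ (dcompA _ _ _)).
apply: (@gap_trivial_pushout _ _ _ _ (sc_incl S) (sc_inclusion KL) phi0 phi _ _ _ f M) => //.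
- split.
  + by apply: smapP => n x; apply: eq_exist.
  + exact: sc_inclusion_inj.
  + by move=> n x y /(congr1 (@proj1_sig _ _)); apply: dhom_lt_inj.
  + move=> n [y hy]; have [hK|hK] := pselect (scmem K y).
      by right; exists (exist _ y hK); apply: eq_exist.
    have [c yc] := dhom_factor mono (LK n y hy hK).
    by left; exists c; apply: eq_exist.
  + move=> n x [y hy] /(congr1 (@proj1_sig _ _)) /= exy.
    have hx : scmem S (x : simplex k n) by apply/SK; rewrite exy.
    by exists (exist _ x hx); split=> //; apply: eq_exist.
- by move=> n y; apply: hM.
Qed.

(** With at most two vertices the spine is the whole face; otherwise the enumeration of [U] carries
    over the Segal condition. *)
Lemma spine_good (U : {set 'I_N.+1}) : good (spine_on U) (face U).
Proof.
have [U3|U3] := leqP 3 #|U|; last first.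
  apply: good_refl => n x xU; split=> // t t' c cU [h1 h2].
  have : [set x t; c; x t'] \subset U.
    by apply/subsetP => y; rewrite !inE => /orP[/orP[]|] /eqP ->.
  have n1 : x t != c by rewrite neq_ltn h1.
  have n2 : c != x t' by rewrite neq_ltn h2.
  have n3 : x t != x t' by rewrite neq_ltn (ltn_trans h1 h2).
  move/subset_leq_card; rewrite -setUA cardsU1 cards2 n2 !inE negb_or n1 n3.
  by move=> /leq_ltn_trans /(_ U3).
have [iota [mono im]] := @dhom_enum N U (ltnW (ltnW U3)).
have mono' i j : iota i < iota j -> i < j := @dhom_le _ _ iota i j.
have U2 : 2 <= #|U|.-1 by lia.
set k := #|U|.-1 in iota mono im mono' U2 *.
apply: (good_transport (iota := iota) (S := spine k) (M := sc_full _)) => //.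
- by move=> n c t; rewrite dcompE; apply/im; exists (c t).
- move=> n c; split.
    case=> i ik h; split=> [t|t t' d]; first by rewrite dcompE; apply/im; exists (c t).
    move/im => [j <-]; rewrite !dcompE => -[/mono' h1 /mono' h2].
    by have := h t; have := h t'; rewrite !inE; lia.
  case=> _ h.
  have c0 t : c ord0 <= c t by apply: dhom_homo.
  have c1 t : c t <= (c ord0).+1.
    rewrite leqNgt; apply/negP => lt.
    have jk : (c ord0).+1 < k.+1 by have := ltn_ord (c t); lia.
    apply: (h ord0 t (iota (Ordinal jk))); first by apply/im; exists (Ordinal jk).
    by rewrite !dcompE; split; apply: mono => /=.
  (* The edge containing [c] starts at its first vertex, except that the last edge must be used when
     [c] is constant at the last vertex [k]. *)
  have ik : minn (c ord0) k.-1 < k.+1 by lia.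
  exists (Ordinal ik); first by rewrite /=; lia.
  by move=> t; rewrite inE /=; have := c0 t; have := c1 t; have := ltn_ord (c t); lia.
- by move=> n y yU _ t; apply/im; apply: yU.
- exact: segal_gap_trivial.
Qed.

(** Starting from the spine of [U], the faces on [L] and [R] are attached in turn, each along its
    own spine. As the spine of [U] is also good in the whole face, two cancellations give the
    result. *)
Lemma split_good (U L R : {set 'I_N.+1}) (x : 'I_N.+1) : x \in U ->
    (forall y, (y \in L) = (y \in U) && (y <= x)) ->
    (forall y, (y \in R) = (y \in U) && (x <= y)) ->
  good (sc_union (face L) (face R)) (face U).
Proof.
move=> xU LE RE.
have spL n (y : simplex N n) : scmem (spine_on U) y -> scmem (face L) y \/ scmem (face R) y.
  case=> yU h; have [hL|hL] := pselect (scmem (face L) y); first by left.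
  right=> t; rewrite RE yU /= leqNgt; apply/negP => tx.
  apply: hL => t'; rewrite LE yU /= leqNgt; apply/negP => xt'.
  exact: (h t t' x).
have sub1 : sc_sub (spine_on U) (sc_union (spine_on U) (face L)) by move=> n y; left.
have sub2 : sc_sub (sc_union (spine_on U) (face L)) (sc_union (face L) (face R)).
  by move=> n y [/spL//|h]; left.
have g1 : good (spine_on U) (sc_union (spine_on U) (face L)).
  apply: (good_attach (K0 := spine_on L) (L0 := face L)) => //; last exact: spine_good.
  - by move=> n y [].
  - move=> n y [yL h]; split=> [t|t t' c cU [h1 h2]]; first by have := yL t; rewrite LE => /andP[].
    apply: (h t t' c) => //; rewrite LE cU /=.
    by have := yL t'; rewrite LE => /andP[_]; apply: leq_trans; apply: ltnW.
  - by move=> n y h; right.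
  - move=> n y [yU h] yL; split=> // t t' c; rewrite LE => /andP[cU _]; exact: h.
apply: (good_cancel sub2); last by apply: (good_cancel sub1 g1); apply: spine_good.
apply: (good_attach (K0 := spine_on R) (L0 := face R)); last exact: spine_good.
- by move=> n y [].
- move=> n y [yR h]; left; split=> [t|t t' c cU [h1 h2]]; first by have := yR t; rewrite RE => /andP[].
  apply: (h t t' c) => //; rewrite RE cU /=.
  by have := yR t; rewrite RE => /andP[_ ]; move=> h3; apply: leq_trans h3 (ltnW h1).
- by move=> n y h; right.
- by move=> n y [h|h]; [left; right|right].
- move=> n y [[yU h]|yL] yR; split=> // t t' c; rewrite RE => /andP[cU xc].
    exact: h.
  move=> [h1 h2].
  by have := yL t'; rewrite LE => /andP[_ h3]; have := leq_ltn_trans xc h2; rewrite ltnNge h3.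
Qed.


(** * From the triangle to the horn *)

Local Notation v0 := (ord0 : 'I_N.+1).
Let v1 : 'I_N.+1 := inord 1.

Lemma val_v1 : v1 = 1 :> nat.
Proof. by rewrite inordK //; lia. Qed.

Lemma edge01_face (U : {set 'I_N.+1}) : v0 \in U -> v1 \in U -> scmem (face U) E01.
Proof.
move=> h0 h1 t.
have [e0|e1] : edge01 N t = v0 \/ edge01 N t = v1.
- have := edge01_val t (ltnW N2); have := ltn_ord t; case: (val t) => [|[|//]] _ h.
    by left; apply: val_inj.
  by right; apply: val_inj; rewrite /= val_v1.
- by rewrite e0.
- by rewrite e1.
Qed.

Lemma triangle_subproof (x : 'I_N.+1) : 1 < x -> forall i j, i <= j -> j <= 2 ->
  (if i is i'.+1 then if i' is 0 then 1 else x else 0) <=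
  (if j is j'.+1 then if j' is 0 then 1 else x : nat else 0) <= N.
Proof. by move=> x1 [|[|i]] [|[|j]] //=; have := ltn_ord x; lia. Qed.

(** The condition on the cocartesian edge, transported along the map with values 0, 1, [x], which
    carries the horn of the triangle to 01 u 0x. *)
Lemma triangle_good (x : 'I_N.+1) : 1 < x ->
  good (sc_union (face [set v0; v1]) (face [set v0; x])) (face [set v0; v1; x]).
Proof.
move=> x1; pose iota := dnat (triangle_subproof x1).
have iE t : iota t = (if t : nat is i'.+1 then if i' is 0 then 1 else x else 0) :> nat.
  exact: dnatE.
have i0 : iota ord0 = v0 by apply: val_inj; rewrite /= iE.
have i1 : iota (inord 1) = v1 by apply: val_inj; rewrite /= iE inordK // val_v1.
have i2 : iota ord_max = x by apply: val_inj; rewrite /= iE.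
have cases (t : 'I_3) : [\/ t = ord0, t = inord 1 | t = ord_max].
  case: t => -[|[|[|//]]] h; [constructor 1|constructor 2|constructor 3]; apply: val_inj => //=.
  by rewrite inordK.
have n01 : v0 != v1 by rewrite -val_eqE /= val_v1.
have n0x : v0 != x by rewrite -val_eqE /= neq_ltn (ltnW x1).
have n1x : v1 != x by rewrite -val_eqE /= val_v1 neq_ltn x1.
have m01 : ord0 != inord 1 :> 'I_3 by rewrite -val_eqE /= inordK.
have m12 : inord 1 != ord_max :> 'I_3 by rewrite -val_eqE /= inordK.
have mono (i j : 'I_3) : i < j -> iota i < iota j.
  by case: (cases i) => ->; case: (cases j) => ->; rewrite ?i0 ?i1 ?i2 ?val_v1 ?inordK //=; lia.
apply: (good_transport (iota := iota) (S := horn (ord0 : 'I_3))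
  (M := edge_fib (horn_edge (leqnn 2)) e)) => //.
- by move=> n c t; rewrite dcompE !inE; case: (cases (c t)) => ->; rewrite ?i0 ?i1 ?i2 eqxx ?orbT.
- move=> n c; split.
    case=> j j0 h; case: (cases j) => ej; subst j.
    + by rewrite eqxx in j0.
    + right=> t; rewrite dcompE !inE; case: (cases (c t)) (h t) => ->; rewrite ?i0 ?i2 ?eqxx ?orbT //.
      by rewrite !inE eqxx.
    + left=> t; rewrite dcompE !inE; case: (cases (c t)) (h t) => ->; rewrite ?i0 ?i1 ?eqxx ?orbT //.
      by rewrite !inE eqxx.
  case=> h.
    exists ord_max => // t; rewrite !inE; apply/negP => /eqP ct.
    by have := h t; rewrite dcompE ct i2 !inE eq_sym (negbTE n0x) eq_sym (negbTE n1x).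
  exists (inord 1); first by rewrite eq_sym.
  move=> t; rewrite !inE; apply/negP => /eqP ct.
  by have := h t; rewrite dcompE ct i1 !inE eq_sym (negbTE n01) (negbTE n1x).
- move=> n y h _ t; have := h t; rewrite !inE => /orP[/orP[]|] /eqP ->.
  + by exists ord0.
  + by exists (inord 1).
  + by exists ord_max.
- move=> phi phiE n z hz; apply/edge_fib_res.
  have hE : scmem (sc_union (face [set v0; v1]) (face [set v0; x])) E01.
    by left; apply: edge01_face; rewrite !inE eqxx ?orbT.
  (* The map [iota] preserves the vertices 0 and 1, so the distinguished edges correspond and the
     two fiber conditions agree. *)
  have -> : phi 1 (horn_edge (leqnn 2)) = exist _ E01 hE; last exact: hz.
  have := phiE 1 (horn_edge (leqnn 2)); case: (phi 1 _) => w hw /= ew.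
  apply: eq_exist; rewrite ew; apply: dhomP => t; rewrite dcompE; apply: val_inj.
  rewrite /= iE (edge01_val t (ltnW N2)) (edge01_val t (ltn0Sn 1)).
  by case: t => -[|[|//]].
- exact: cocartesian_gap_trivial segal_X.1 segal_Y.1 coc.
Qed.

Definition vcone (V : {set 'I_N.+1}) : {set 'I_N.+1} := v0 |: (v1 |: V).

(** The complex 01 u 0V with the faces of 01V opposite to the vertices in [s]. It interpolates
    between 01 u 0V and, when [V] is all vertices > 1 and [s] lists them, the horn. *)
Definition partial_horn (V : {set 'I_N.+1}) (s : seq 'I_N.+1) : subcpx (simplex N) :=
  sc_union (sc_union (face [set v0; v1]) (face (v0 |: V)))
    (sc_bigcup (fun j => j \in s) (fun j => face (vcone V :\ j))).

Lemma partial_horn_nil_good (V : {set 'I_N.+1}) :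
  (forall y, y \in V -> 1 < y) -> 0 < #|V| -> good (partial_horn V [::]) (face (vcone V)).
Proof.
move=> V1 /card_gt0P[x0 x0V].
case: (@arg_minnP _ x0 (mem V) (@nat_of_ord _) x0V) => x xV xmin.
have {}xV : x \in V := xV.
have {}xmin y : y \in V -> x <= y := xmin y.
have x1 := V1 x xV.
have n01 : v0 != v1 by rewrite -val_eqE /= val_v1.
have nV0 y : y \in V -> y != v0 by move=> /V1; rewrite -val_eqE /=; lia.
have nV1 y : y \in V -> y != v1 by move=> /V1; rewrite -val_eqE /= val_v1; lia.
pose S := sc_union (face [set v0; v1]) (face [set v0; x]).
pose A := sc_union S (face V).
pose B := sc_union (face [set v0; v1; x]) (face V).
pose Q := partial_horn V [::].
have AB : sc_sub A B.
  move=> n y [[h|h]|h]; [left|left|by right] => t; have := h t; rewrite !inE.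
    by move=> ->.
  by case/orP => ->; rewrite ?orbT.
have BU : sc_sub B (face (vcone V)).
  move=> n y [h|h] t; have := h t; rewrite !inE; last by move=> ->; rewrite !orbT.
  by case/orP => [/orP[]|] /eqP ->; rewrite ?eqxx ?xV /= ?orbT.
have AQ : sc_sub A Q.
  move=> n y [[h|h]|h]; left; [by left|right|right] => t; have := h t; rewrite !inE.
    by case/orP => /eqP ->; rewrite ?eqxx ?xV /= ?orbT.
  by move=> ->; rewrite orbT.
(* The triangle 01x is attached along 01 u 0x, which already contains its intersection with [V],
   namely the vertex [x]. *)
have gAB : good A B.
  apply: (good_attach (K0 := S) (L0 := face [set v0; v1; x])); last exact: triangle_good.
  - move=> n y [h|h] t; have := h t; rewrite !inE; first by move=> ->.
    by case/orP => ->; rewrite ?orbT.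
  - by move=> n y h; left.
  - by move=> n y h; left.
  - by move=> n y [h|h]; [right|left; right].
  - move=> n y [//|h] h'; right=> t; have := h t => ytV; have := h' t; rewrite !inE.
    by rewrite (negbTE (nV1 _ ytV)) orbF.
(* The vertices of 01V up to [x] are 0, 1 and [x]; those from [x] on are [V]. *)
have gBU : good B (face (vcone V)).
  apply: (@split_good _ _ _ x).
  - by rewrite !inE xV !orbT.
  - move=> y; rewrite !inE; apply/idP/idP.
      case/orP => [/orP[]|] /eqP ->; rewrite ?eqxx ?xV /= ?orbT ?leqnn //=.
      by rewrite val_v1 ltnW.
    case/andP => /orP[->//|/orP[->|yV]] yx; first by rewrite orbT.
    have := xmin y yV; rewrite leq_eqVlt ltnNge yx orbF => /eqP/val_inj ->.
    by rewrite eqxx !orbT.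
  - move=> y; rewrite !inE; apply/idP/idP => [yV|].
      by rewrite yV !orbT; apply: xmin.
    case/andP => /orP[/eqP->|/orP[/eqP->|//]]; first by rewrite leqNgt ltnW.
    by rewrite val_v1 leqNgt x1.
(* The face 0V is attached along 0x u V, and this inclusion is again a splitting at [x]. *)
have gAQ : good A Q.
  apply: (good_attach (K0 := sc_union (face [set v0; x]) (face V)) (L0 := face (v0 |: V))).
  - move=> n y [h|h] t; have := h t; rewrite !inE; last by move=> ->; rewrite orbT.
    by case/orP => /eqP ->; rewrite ?eqxx ?xV /= ?orbT.
  - by move=> n y [h|h]; [left; right|right].
  - by move=> n y h; left; right.
  - by move=> n y [[h|h]|[]//]; [left; left; left|right].
  - move=> n y [[h|h]|h] h'; [|by left|by right].
    left=> t; have := h t; rewrite !inE => /orP[->//|/eqP yt].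
    by have := h' t; rewrite yt !inE (eq_sym v1) (negbTE n01) /= => /nV1; rewrite eqxx.
  apply: (@split_good _ _ _ x).
  - by rewrite !inE xV !orbT.
  - move=> y; rewrite !inE; apply/idP/idP.
      by case/orP => /eqP ->; rewrite ?eqxx ?xV /= ?orbT ?leqnn.
    case/andP => /orP[->//|yV] yx.
    have := xmin y yV; rewrite leq_eqVlt ltnNge yx orbF => /eqP/val_inj ->.
    by rewrite eqxx !orbT.
  - move=> y; rewrite !inE; apply/idP/idP => [yV|].
      by rewrite yV !orbT; apply: xmin.
    by case/andP => /orP[/eqP->|//]; rewrite leqNgt ltnW.
have gAU : good A (face (vcone V)).
  apply: good_comp gAB gBU => //.
  by left; left; apply: edge01_face; rewrite !inE eqxx ?orbT.
exact: good_cancel gAQ gAU.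
Qed.

(** Induction on the size of [V] and then on [s]. The face opposite [j] meets the complex already
    built in the partial horn of [V :\ j], so attaching it is good by the outer induction;
    cancellation against the inner one finishes. *)
Lemma partial_horn_good (V : {set 'I_N.+1}) (s : seq 'I_N.+1) :
    (forall y, y \in V -> 1 < y) -> 0 < #|V| -> (forall y, y \in s -> 1 < y) ->
  good (partial_horn V s) (face (vcone V)).
Proof.
have [k] := ubnP #|V|; elim: k V s => // k IHk V s Vk V1 V0.
elim: s => [|j s IHs] s1; first exact: partial_horn_nil_good.
have j1 : 1 < j by apply: s1; rewrite inE eqxx.
have nj0 : j != v0 by rewrite -val_eqE /=; lia.
have nj1 : j != v1 by rewrite -val_eqE /= val_v1; lia.
have n01 : v1 != v0 by rewrite -val_eqE /= val_v1.
have {}s1 y : y \in s -> 1 < y by move=> ys; apply: s1; rewrite inE ys orbT.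
have {}IHs := IHs s1.
(* If [j] is not in [V], removing it changes nothing, and the partial horn is already the whole
   face. *)
have [jV|jV] := boolP (j \in V); last first.
  apply: good_refl => n y h; right; exists j; first by rewrite inE eqxx.
  move=> t; have := h t; rewrite in_setD1 => yt; rewrite yt andbT.
  by apply: contraTN yt => /eqP ->; rewrite !inE (negbTE nj0) (negbTE nj1).
have sub : sc_sub (partial_horn V s) (partial_horn V (j :: s)).
  by move=> n y [h|[i si h]]; [left|right; exists i => //; rewrite inE si orbT].
apply: (good_cancel sub _ IHs).
have vconeD : vcone (V :\ j) = vcone V :\ j.
  apply/setP => y; rewrite !inE.
  by have [->|ny] := eqVneq y j; rewrite ?(negbTE nj0) ?(negbTE nj1).
(* If [j] is the only vertex of [V], the face opposite to it is the edge 01, which is already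
   present. *)
have [V'0|V'0] := posnP #|V :\ j|.
  apply: good_refl => n y [h|[i]]; first by left.
  rewrite inE => /orP[/eqP ->|si] h; last by right; exists i.
  left; left=> t; have := h t; rewrite -vconeD.
  by move/cards0_eq: V'0 => ->; rewrite !inE orbF.
apply: (good_attach (K0 := partial_horn (V :\ j) s) (L0 := face (vcone (V :\ j)))).
- move=> n y [[h|h]|[i si h]] t; have := h t; rewrite !inE.
  + by case/orP => ->; rewrite ?orbT.
  + by case/orP => ->; rewrite ?orbT.
  + by case/andP.
- move=> n y [[h|h]|[i si h]]; [by left; left|left; right|right; exists i => //] => t; have := h t; rewrite !inE.
  + by case/orP => [->//|/andP[_ ->]]; rewrite orbT.
  + by case/andP => -> /orP[->|/orP[->|/andP[_ ->]]]; rewrite ?orbT.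
- by move=> n y h; right; exists j; rewrite ?inE ?eqxx // -vconeD.
- move=> n y [h|[i]]; first by left; left.
  by rewrite inE => /orP[/eqP ->|si] h; [right; rewrite vconeD|left; right; exists i].
- move=> n y [[h|h]|[i si h]] h'.
  + by left; left.
  + left; right=> t; have := h t; have := h' t; rewrite !inE.
    case/orP => [->//|/orP[/eqP ->|->]]; last by rewrite orbT.
    by rewrite (negbTE n01) /= => /V1; rewrite val_v1.
  + right; exists i => // t; have := h t; have := h' t; rewrite !in_setD1.
    by move=> -> /andP[->].
apply: IHk => //; last first.
  by move=> y; rewrite inE => /andP[_]; apply: V1.
by move: Vk; rewrite (cardsD1 j V) jV add1n ltnS.
Qed.

Lemma horn_gap_trivial : gap_trivial f (horn0_incl N) (edge_fib (horn_edge N2) e).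
Proof.
pose V := [set y : 'I_N.+1 | 1 < y].
have V1 y : y \in V -> 1 < y by rewrite inE.
have full y : y \in vcone V.
  rewrite !inE -!val_eqE /= val_v1; lia.
have V0 : 0 < #|V| by apply/card_gt0P; exists ord_max; rewrite inE /=; lia.
have n01 : v1 != v0 by rewrite -val_eqE /= val_v1.
have hornE n (y : simplex N n) : scmem (partial_horn V (enum V)) y <-> scmem (horn v0) y.
  split.
  - case=> [[h|h]|[i si h]].
    + exists ord_max; first by rewrite -val_eqE /=; lia.
      move=> t; rewrite !inE; apply/negP => /eqP yt; have := h t.
      by rewrite yt !inE -!val_eqE /= val_v1; lia.
    + exists v1 => // t; rewrite !inE; apply/negP => /eqP yt; have := h t.
      by rewrite yt !inE (negbTE n01) val_v1.
    + exists i; first by move: si; rewrite mem_enum inE -val_eqE /=; lia.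
      by move=> t; have := h t; rewrite !inE => /andP[].
  (* The face opposite the vertex 1 is 0V; every other admissible [i] belongs to [V]. *)
  - case=> i i0 h; have [ei|ni] := eqVneq i v1.
      left; right=> t; have := h t; have := full (y t); rewrite !inE ei.
      by case/orP => [->//|/orP[->//|->]]; rewrite orbT.
    right; exists i.
      by rewrite mem_enum; have := full i; rewrite !inE (negbTE i0) (negbTE ni).
    by move=> t; have := h t; rewrite in_setC1 in_setD1 full => ->.
have g := @partial_horn_good V (enum V) V1 V0 (fun y h => V1 y (etrans (esym (mem_enum _ _)) h)).
have PU : sc_sub (partial_horn V (enum V)) (face (vcone V)) by move=> n y _ t.
have PH : sc_sub (partial_horn V (enum V)) (horn v0) by move=> n y /hornE.
(* Since [vcone V] contains every vertex, both horizontal maps of this square are isomorphisms; it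
   only replaces the partial horn and the full face by the horn and the simplex. *)
apply: (gap_trivial_pushout (phi0 := sc_inclusion PH) (phi := sc_incl (face (vcone V))) _ _ (g PU)).
- split.
  + exact: smapP.
  + by move=> n [x hx] [y hy] /= exy; apply: eq_exist.
  + by move=> n [x hx] [y hy] /= exy; apply: eq_exist.
  + by move=> n y; left; exists (exist _ y (fun t => full (y t))).
  + move=> n [x hx] [y hy] /= exy; subst y.
    by exists (exist _ x ((hornE n x).2 hy)); split; apply: eq_exist.
- move=> n y hy h; apply/edge_fib_res.
  have -> // : sc_inclusion PH 1 (exist _ E01 h) = horn_edge N2 by apply: eq_exist.
Qed.

End Good.

Theorem mainTheorem3 (X Y : bsSet) (f : bmap X Y) (e : X 1 0) :
  segal_space X -> segal_space Y -> reedy_fibration f -> cocartesian f e ->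
  forall (n : nat) (n2 : 2 <= n),
    trivial_fibration (bfib_gap (horn0_incl n) (horn_edge n2) f e).
Proof.
move=> sX sY rf coc n n2; apply: bfib_trivial_fibration => //.
  exact: sc_incl_mono.
exact: horn_gap_trivial.
Qed.
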